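(* Let $\mathbb{N}$ be equipped with the discrete $\sigma$-algebra. Let $\mathsf{es}_{\mathbb{N}}:\mathbb{N}^{\mathbb{N}}\to\mathbb{N}$ be defined as follows: a sequence $(x_i)\in\mathbb{N}^{\mathbb{N}}$ belongs to the domain of $\mathsf{es}_{\mathbb{N}}$ if and only if the limits $$\lim_{n\to\infty}\frac{|\{i\le n\mid x_i\le t\}|}{n}$$ exist uniformly in $t\in\mathbb{N}$, and in this case $$\mathsf{es}_{\mathbb{N}}\bigl(T\,|\,(x_i)\bigr)=\lim_{n\to\infty}\frac{|\{i\le n\mid x_i\in T\}|}{n}$$ for every $T\subseteq\mathbb{N}$. Then $\mathsf{es}_{\mathbb{N}}$ is an empirical sampling morphism for $\mathbb{N}$ in $\mathsf{Partial}(\mathsf{BorelStoch})$.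
   Context: $\mathbb{N}=\{1,2,3,\ldots\}$. $\mathsf{Partial}(\mathsf{BorelStoch})$ has standard Borel spaces as objects. A morphism $f:X\to Y$ is a partial Markov kernel: a measurable set $D_f\subseteq X$ (its domain) together with a Markov kernel $f(\cdot|x)$, $x\in D_f$, from $D_f$ to $Y$. The composite of $f:X\to Y$ and $g:Y\to Z$ has domain $D_{gf}=\{x\in D_f\mid f(D_g|x)=1\}$ and on it $(gf)(S|x)=\int_{D_g}g(S|y)\,f(dy|x)$. The tensor product of objects is the cartesian product with product $\sigma$-algebra; $f\otimes g$ for $f:A\to X$, $g:B\to Y$ has domain $D_f\times D_g$ and is given there by product measures. Two morphisms are equal iff they have the same domain and the same kernel on it. The Kolmogorov power $X^{\mathbb{N}}$ is the countable product with product $\sigma$-algebra. For a morphism $f:A\to X$, $f^{(\mathbb{N})}:A\to X^{\mathbb{N}}$ has domain $D_f$ and sends $a$ to the infinite product measure $f(\cdot|a)^{\otimes\mathbb{N}}$. For a finite permutation $\sigma$ of $\mathbb{N}$ (a bijection fixing all but finitely many elements), $X^\sigma:X^{\mathbb{N}}\to X^{\mathbb{N}}$ is the (everywhere defined) deterministic kernel given by $(x_i)\mapsto(x_{\sigma(i)})$. A morphism $f:A\to X^{\mathbb{N}}\otimes Y$ is exchangeable in the first factor if $(X^\sigma\otimes \mathrm{id}_Y)\,f=f$ for every finite permutation $\sigma$. An empirical sampling morphism for $X$ is a morphism $\mathsf{es}:X^{\mathbb{N}}\to X$ (so in particular its domain is measurable and it is a Markov kernel on it) such that: (i) (permutation invariance)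 $\mathsf{es}\,X^\sigma=\mathsf{es}$ for every finite permutation $\sigma$ of $\mathbb{N}$; (ii) (empirical adequacy) for all objects $A,Y$ and every morphism $f:A\to X^{\mathbb{N}}\otimes Y$ exchangeable in the first factor, $(\mathsf{es}^{(\mathbb{N})}\otimes \mathrm{id}_Y)\,f=f$. *)

(* Defs.v *)
From HB Require Import structures.
From mathcomp Require Import all_boot all_order all_algebra.
From mathcomp Require Import all_classical all_reals all_analysis.
From mathcomp Require Import measurable_realfun giry.

Set Implicit Arguments.
Unset Strict Implicit.
Unset Printing Implicit Defensive.

Import Order.TTheory GRing.Theory Num.Theory.
Import numFieldNormedType.Exports.

Local Open Scope classical_set_scope.
Local Open Scope ring_scope.
Local Open Scope ereal_scope.

(* The metric of a Polish space is a complete pseudometric whose topology is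
   Hausdorff, so that it is a metric. *)
Definition standard_borel (R : realType) d (T : measurableType d) : Prop :=
  exists (M : completePseudoMetricType R) (f : T -> M),
    [/\ hausdorff_space M,
        exists2 S : set M, countable S & dense S,
        bijective f &
        forall A : set T, measurable A <-> <<s @open M >> (f @` A)].

Lemma cauchy_cvg_dnat (F : set_system (discrete_topology nat)) :
  ProperFilter F -> cauchy F -> cvg F.
Proof.
move=> FF Fc.
have : entourage [set xy : discrete_topology nat * discrete_topology nat | xy.1 = xy.2].
  by rewrite uniform_discrete => _ [n _ <-].
move=> /Fc [[A B] /= [FA FB] AB].
have [x [Ax Bx]] := @filter_ex _ F FF _ (filterI FA FB).
apply/cvg_ex; exists x; apply/discrete_cvg; apply: filterS FA => y Ay.
exact: (AB (y, x)).
Qed.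

HB.instance Definition _ := Uniform_isComplete.Build (discrete_topology nat) cauchy_cvg_dnat.

Lemma standard_borel_nat (R : realType) : standard_borel R nat.
Proof.
exists (discrete_topology nat), id; split.
- exact: discrete_hausdorff.
- exists setT; first exact: countableP.
  by move=> U [x Ux] _; exists x.
- by exists id.
- move=> A; split => // _; apply: sub_sigma_algebra; exact: discrete_open.
Qed.

(* Partial Markov kernels. Off the domain, the values of [pker] are
   meaningless: [pk_eq] and all the constructions below ignore them. *)
Record pkernel (R : realType) d d' (X : measurableType d)
    (Y : measurableType d') := PKernel {
  pdom : set X ;
  pker :> X -> subprobability Y R ;
  measurable_pdom : measurable pdom ;
  measurable_pker : forall U : set Y, measurable U ->
    measurable_fun pdom (fun x => pker x U) ;
  pker_setT : forall x, pdom x -> pker x setT = 1 }.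

Arguments pkernel R {d d'} X Y.

Definition pk_eq (R : realType) d d' (X : measurableType d)
    (Y : measurableType d') (f g : pkernel R X Y) : Prop :=
  pdom f = pdom g /\
  forall x, pdom f x -> forall S : set Y, measurable S -> f x S = g x S.

Section extension_by_zero.
Context (R : realType) d d' (X : measurableType d) (Y : measurableType d').
Variable f : pkernel R X Y.

Definition pker0 (x : X) : giry Y R := if x \in pdom f then f x else mzero.

Lemma measurable_pker0 : measurable_fun setT pker0.
Proof.
apply: measurable_giry_codensity => // U mU.
rewrite (_ : pker0 ^~ U = (fun x => f x U) \_ (pdom f)).
  by apply/(measurable_restrictT _ (measurable_pdom f)); exact: measurable_pker.
by apply/funext => x; rewrite /pker0 patchE; case: ifPn.
Qed.

End extension_by_zero.

Section composition.
Context (R : realType) d1 d2 d3 (X : measurableType d1)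
  (Y : measurableType d2) (Z : measurableType d3).
Variables (g : pkernel R Y Z) (f : pkernel R X Y).

Definition pcomp_dom : set X := [set x | pdom f x /\ f x (pdom g) = 1].

Definition pcomp_ker (x : X) (S : set Z) : \bar R :=
  \int[f x]_(y in pdom g) g y S.

Let pcomp_ker0 x : pcomp_ker x set0 = 0.
Proof. by apply: integral0_eq => y _; rewrite measure0. Qed.

Let pcomp_ker_ge0 x S : 0 <= pcomp_ker x S.
Proof. exact: integral_ge0. Qed.

Let pcomp_ker_sigma_additive x : semi_sigma_additive (pcomp_ker x).
Proof.
move=> F mF tF mUF; rewrite [X in _ --> X](_ : _ =
    \int[f x]_(y in pdom g) \sum_(0 <= k <oo) g y (F k)); last first.
  by apply: eq_integral => y _; apply/esym/cvg_lim => //; exact: measure_sigma_additive.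
rewrite [X in X @ _](_ : _ =
    (fun n => \int[f x]_(y in pdom g) (\sum_(0 <= i < n) g y (F i)))); last first.
  apply/funext => n; rewrite -ge0_integral_sum//.
  - exact: measurable_pdom.
  - by move=> i; exact: measurable_pker.
apply: cvg_monotone_convergence => //.
- exact: measurable_pdom.
- by move=> n; apply: emeasurable_sum => m; exact: measurable_pker.
- by move=> n y _; rewrite sume_ge0.
- by move=> y _ m n mn; exact: ereal_nondecreasing_series.
Qed.

HB.instance Definition _ x := isMeasure.Build _ _ R (pcomp_ker x)
  (pcomp_ker0 x) (pcomp_ker_ge0 x) (@pcomp_ker_sigma_additive x).

Let pcomp_ker_setT x : pcomp_ker x setT = f x (pdom g).
Proof.
rewrite /pcomp_ker (eq_integral (cst 1)).
  by rewrite integral_cst ?mul1e//; exact: measurable_pdom.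
by move=> y /set_mem gy; rewrite pker_setT.
Qed.

Let pcomp_ker_le1 x : pcomp_ker x setT <= 1.
Proof.
rewrite pcomp_ker_setT (le_trans _ (@sprobability_setT _ _ _ (f x)))//.
by rewrite le_measure// ?inE//; exact: measurable_pdom.
Qed.

HB.instance Definition _ x := Measure_isSubProbability.Build _ _ R
  (pcomp_ker x) (pcomp_ker_le1 x).

Let measurable_pcomp_dom : measurable pcomp_dom.
Proof.
rewrite (_ : pcomp_dom = pdom f `&` (fun x => f x (pdom g)) @^-1` [set 1])//.
by apply: measurable_pker => //; exact: measurable_pdom.
Qed.

Let measurable_pcomp_ker (S : set Z) : measurable S ->
  measurable_fun pcomp_dom (pcomp_ker ^~ S).
Proof.
move=> mS; apply: (@measurable_funS _ _ _ _ (pdom f)).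
- exact: measurable_pdom.
- by move=> x [].
apply: (eq_measurable_fun
    (fun x => giry_int (pker0 f x) ((fun y => g y S) \_ (pdom g)))).
  by move=> x xf; rewrite /pker0 xf /pcomp_ker [RHS]integral_mkcond.
apply: measurable_funTS.
have mi : measurable_fun setT
    (fun m : giry Y R => giry_int m ((fun y => g y S) \_ (pdom g))).
  apply: measurable_giry_int => [|y]; last by rewrite patchE; case: ifPn.
  by apply/(measurable_restrictT _ (measurable_pdom g)); exact: measurable_pker.
exact: (measurableT_comp mi (measurable_pker0 f)).
Qed.

Let pcomp_setT x : pcomp_dom x -> pcomp_ker x setT = 1.
Proof. by case=> _ fx1; rewrite pcomp_ker_setT. Qed.

Definition pk_comp : pkernel R X Z :=
  @PKernel R _ _ X Z pcomp_dom (fun x => pcomp_ker x : subprobability Z R)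
    measurable_pcomp_dom measurable_pcomp_ker pcomp_setT.

End composition.

Section tensor.
Context (R : realType) dA dB dX dY (A : measurableType dA)
  (B : measurableType dB) (X : measurableType dX) (Y : measurableType dY).
Variables (f : pkernel R A X) (g : pkernel R B Y).

Definition ptensor_dom : set (A * B) := pdom f `*` pdom g.

Definition ptensor_ker (ab : A * B) : subprobability (X * Y)%type R :=
  product_subprobability (f ab.1, g ab.2).

Let measurable_ptensor_dom : measurable ptensor_dom.
Proof. by apply: measurableX; exact: measurable_pdom. Qed.

Let measurable_ptensor_ker (U : set (X * Y)) : measurable U ->
  measurable_fun ptensor_dom (fun ab => ptensor_ker ab U).
Proof.
move=> mU.
have mfg : measurable_fun setT (fun ab => (pker0 f ab.1, pker0 g ab.2)).
  apply: measurable_fun_pair.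
    exact: (measurableT_comp (measurable_pker0 f) measurable_fst).
  exact: (measurableT_comp (measurable_pker0 g) measurable_snd).
have mp : measurable_fun setT
    (fun m : giry X R * giry Y R => giry_ev (giry_prod m) U).
  exact: (measurableT_comp (measurable_giry_ev mU) measurable_giry_prod).
apply: (eq_measurable_fun
    (fun ab => giry_ev (giry_prod (pker0 f ab.1, pker0 g ab.2)) U)).
  by move=> ab /set_mem[fa gb]; rewrite /pker0 !mem_set.
by apply: measurable_funTS; exact: (measurableT_comp mp mfg).
Qed.

Let ptensor_setT ab : ptensor_dom ab -> ptensor_ker ab setT = 1.
Proof.
move=> [fa gb]; rewrite /ptensor_ker/= -setXTT.
transitivity (f ab.1 setT * g ab.2 setT); first exact: product_measure1E.
by rewrite (pker_setT fa) (pker_setT gb) mule1.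
Qed.

Definition pk_tensor : pkernel R (A * B)%type (X * Y)%type :=
  PKernel measurable_ptensor_dom measurable_ptensor_ker ptensor_setT.

End tensor.

Section deterministic.
Context (R : realType) d d' (X : measurableType d) (Y : measurableType d').
Variables (h : X -> Y) (mh : measurable_fun setT h).

Let measurable_pdet_ker (U : set Y) : measurable U ->
  measurable_fun setT (fun x => (dirac (h x) : subprobability Y R) U).
Proof.
by move=> mU; apply: (measurableT_comp (measurable_fun_dirac mU) mh).
Qed.

Definition pk_det : pkernel R X Y :=
  @PKernel R _ _ X Y setT (fun x => dirac (h x) : subprobability Y R)
    measurableT measurable_pdet_ker (fun x _ => diracT R (h x)).

End deterministic.

Definition pk_id (R : realType) d (X : measurableType d) : pkernel R X X :=
  pk_det R (@measurable_id _ X setT).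

Definition coord_cylinders d (X : measurableType d) : set (set (nat -> X)) :=
  [set C | exists i, exists2 B : set X, measurable B & C = [set x | B (x i)]].
Arguments coord_cylinders {d} X.

Definition kpow d (X : measurableType d) :
    measurableType (coord_cylinders X).-sigma :=
  g_sigma_algebraType (coord_cylinders X).

Definition permute d (X : measurableType d) (s : nat -> nat) :
  kpow X -> kpow X := fun x i => x (s i).

Lemma measurable_permute d (X : measurableType d) (s : nat -> nat) :
  measurable_fun setT (@permute d X s).
Proof.
apply: (@measurability _ _ (kpow X) (kpow X) setT (@permute d X s)
  (coord_cylinders X)) => // _ [_ [i [B mB ->]] <-].
by rewrite setTI; apply: sub_sigma_algebra; exists (s i); exists B.
Qed.

Definition pk_permute (R : realType) d (X : measurableType d)
    (s : nat -> nat) : pkernel R (kpow X) (kpow X) :=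
  pk_det R (@measurable_permute d X s).

Definition finite_permutation (s : nat -> nat) : Prop :=
  bijective s /\ finite_set [set i | s i != i].

Definition exchangeable (R : realType) dA dX dY (A : measurableType dA)
    (X : measurableType dX) (Y : measurableType dY)
    (f : pkernel R A (kpow X * Y)%type) : Prop :=
  forall s, finite_permutation s ->
    pk_eq (pk_comp (pk_tensor (pk_permute R X s) (pk_id R Y)) f) f.

(* [q] is the infinite product measure of countably many copies of [p] *)
Definition is_iid_measure (R : realType) d (X : measurableType d)
    (p : set X -> \bar R) (q : set (kpow X) -> \bar R) : Prop :=
  forall (n : nat) (B : nat -> set X), (forall i, measurable (B i)) ->
    q [set x | forall i, (i < n)%N -> B i (x i)] = \prod_(i < n) p (B i).

(* [fN] is the power of [f]; it is unique up to [pk_eq], see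
   [is_kpower_unique] *)
Definition is_kpower (R : realType) dA dX (A : measurableType dA)
    (X : measurableType dX) (f : pkernel R A X) (fN : pkernel R A (kpow X)) :
    Prop :=
  pdom fN = pdom f /\ forall a, pdom f a -> is_iid_measure (f a) (fN a).

Lemma is_iid_measure_unique (R : realType) d (X : measurableType d)
    (p : set X -> \bar R) (q q' : subprobability (kpow X) R) :
  is_iid_measure p q -> is_iid_measure p q' ->
  forall S : set (kpow X), measurable S -> q S = q' S.
Proof.
move=> pq pq'.
pose C : set (set (kpow X)) := [set S | exists n, exists2 B : nat -> set X,
  forall i, measurable (B i) & S = [set x | forall i, (i < n)%N -> B i (x i)]].
have CE n (B : nat -> set X) : [set x : kpow X | forall i, (i < n)%N -> B i (x i)]
    = \bigcap_(i in [set i | (i < n)%N]) [set x : kpow X | B i (x i)].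
  by apply/seteqP; split.
apply: (measure_unique C (fun=> setT)).
- apply/seteqP; split.
    apply: smallest_sub; first exact: smallest_sigma_algebra.
    move=> _ [i [B mB ->]]; apply: sub_sigma_algebra.
    exists i.+1, (fun j => if j == i then B else setT) => [j|].
      by case: ifP.
    apply/seteqP; split => [x Bx j _|x /(_ i (ltnSn i))]; last by rewrite eqxx.
    by case: eqP => [->|].
  apply: smallest_sub; first exact: smallest_sigma_algebra.
  move=> _ [n [B mB ->]]; rewrite CE.
  apply: (@bigcap_measurableType _ (kpow X)) => i _.
  by apply: sub_sigma_algebra; exists i; exists (B i).
- move=> _ _ [n [B mB ->]] [m [B' mB' ->]].
  exists (maxn n m), (fun i => (if (i < n)%N then B i else setT) `&`
                      (if (i < m)%N then B' i else setT)) => [i|].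
    by apply: measurableI; case: ifP.
  apply/seteqP; split => [x [Bx B'x] i _|x h].
    by split; case: ifP => // im; [exact: Bx|exact: B'x].
  by split => i im; have := h i; rewrite leq_max im ?orbT => /(_ isT) [].
- by move=> _; exists 0%N, (fun=> setT) => //; apply/seteqP; split.
- by apply/seteqP; split => // x _; exists 0%N.
- by move=> S [n [B mB ->]]; exact: (etrans (pq n B mB) (esym (pq' n B mB))).
- by move=> _; rewrite (le_lt_trans (@sprobability_setT _ _ _ q))// ltry.
Qed.

Lemma is_kpower_unique (R : realType) dA dX (A : measurableType dA)
    (X : measurableType dX) (f : pkernel R A X) (g h : pkernel R A (kpow X)) :
  is_kpower f g -> is_kpower f h -> pk_eq g h.
Proof.
move=> [gf fg] [hf fh]; split; first by rewrite gf hf.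
move=> a; rewrite gf => fa; exact: is_iid_measure_unique (fg a fa) (fh a fa).
Qed.

(* A [measurableType] is never empty. The empty objects A or Y left out here
   contribute nothing: the only morphism into X^N * Y is then the nowhere
   defined one, for which empirical adequacy is trivial. *)
Definition empirical_sampling (R : realType) d (X : measurableType d)
    (es : pkernel R (kpow X) X) : Prop :=
  (forall s, finite_permutation s -> pk_eq (pk_comp es (pk_permute R X s)) es)
  /\
  (exists2 esN : pkernel R (kpow X) (kpow X), is_kpower es esN &
    forall dA dY (A : measurableType dA) (Y : measurableType dY),
    standard_borel R A -> standard_borel R Y ->
    forall f : pkernel R A (kpow X * Y)%type, exchangeable f ->
      pk_eq (pk_comp (pk_tensor esN (pk_id R Y)) f) f).

(* The set {1, 2, 3, ...} is represented by [nat], m + 1 being represented by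
   m: the first n terms of a sequence are those of index i < n, and
   {1, ..., t + 1} is [set m | m <= t]. *)
Definition freq (R : realType) (x : nat -> nat) (T : set nat) (n : nat) : R :=
  (#|[pred i : 'I_n | x i \in T]|%:R / n%:R)%R.

Definition uniform_cdf_limit (R : realType) (x : nat -> nat) : Prop :=
  exists F : nat -> R,
    {uniform, (fun n t => freq R x [set m | (m <= t)%N] n) @ \oo --> F}.

Lemma uniform_cdf_limitP (R : realType) (x : nat -> nat) :
  uniform_cdf_limit R x <-> exists F : nat -> R, forall e : R, (0 < e)%R ->
   \forall n \near \oo, forall t, (`|F t - freq R x [set m | (m <= t)%N] n| < e)%R.
Proof.
split=> [] [F HF]; exists F.
- move=> e e0.
  apply: (HF [set g : {uniform nat -> R} | forall t, (`|F t - g t| < e)%R]).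
  apply/uniform_nbhs; exists [set xy : R * R | `|xy.1 - xy.2| < e]%R; split.
    by rewrite -entourage_ballE; exists e.
  by move=> g h t; exact: (h t).
- move=> P /uniform_nbhs[E [entE EP]].
  move: entE; rewrite -entourage_ballE => -[e e0 be].
  apply: filterS (HF e e0) => n Hn; apply: EP => t _; apply: be; exact: Hn.
Qed.

(* Main.v *)
From HB Require Import structures.
Require Import Defs.
From mathcomp Require Import all_boot all_order all_algebra.
From mathcomp Require Import all_classical all_reals all_analysis.
From mathcomp Require Import measurable_realfun giry.
From mathcomp Require Import ring lra zify.
Import Order.TTheory GRing.Theory Num.Theory.
Import numFieldNormedType.Exports.
Local Open Scope classical_set_scope.
Local Open Scope ring_scope.
Local Open Scope ereal_scope.

(** The domain of the kernel is determined by a tightness phenomenon. If the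
    empirical distribution functions of a sequence converge uniformly, the limit
    tends to 1 at infinity because each empirical distribution function does; no
    mass escapes, so the frequency of every set converges
    ([uniform_cdf_limit_tight], [cvgn_freq]) and the limits form a probability
    measure ([lim_freq_sigma_additive]). Conversely pointwise convergence together
    with tightness gives uniform convergence ([tight_uniform_cdf_limit]), which is
    how membership in the domain is proved. A finite permutation only reorders an
    initial segment, hence changes no limit ([sampling_permute]).

    The power of the kernel needs independent sequences with a prescribed law [p]
    on the natural numbers. Cut the unit interval into consecutive intervals of
    lengths [p {0}], [p {1}], ...; the index of the interval containing a uniform
    point has law [p], and the rescaled position of the point inside that interval
    is again uniform and independent of the index. Iterating produces the sequence
    ([iid_exists]).

    Empirical adequacy is de Finetti's theorem with an extra component [Y]. Let
    [mu] be the law of an exchangeable sequence paired with an element of [Y]; it is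
    invariant under transpositions of the terms.

    - Almost every sequence is in the domain. The correlation of two distinct
      indicators of a set [T] does not depend on the indices, so the frequencies
      [M n] of [T] satisfy [E (M n - M m)^2 <= 1/n] for [n <= m]
      ([expectation_sqr_freqB]). Along fourth powers the increments are then
      summable almost surely, and between two such indices the frequencies move
      little, so they converge almost surely ([ae_cvgn_freq]). Tightness follows
      from Fatou's lemma, the expected frequency of [{m | t < m}] being the
      probability that the first term exceeds [t] ([ae_uniform_cdf_limit]).

    - Given the limiting frequencies the terms are independent. A bounded
      function [W] that is invariant under the swaps of [k] with larger indices has
      the same correlation with every term of index at least [k]; averaging over
      these terms replaces the indicator of [B] at the term [k] by the limiting
      frequency of [B]. Doing this for one coordinate after the other turns the
      probability of a cylinder into the expected product of limiting frequencies
      ([expectation_prod_limit_law]).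

    This identifies both sides of the adequacy equation on the rectangles whose
    first side is a cylinder, which generate the product sigma-algebra and are
    stable under intersection ([sampling_adequate]). *)

Set Implicit Arguments.
Unset Strict Implicit.
Unset Printing Implicit Defensive.

(** * Independent sequences with a given law on the natural numbers *)

(** [pushforward] bundled with the proof of measurability, from which its measure
    structure is built. *)
Definition image_measure d d' (R : realType) (T : measurableType d)
    (T' : measurableType d') (m : {measure set T -> \bar R}) (f : T -> T')
    (mf : measurable_fun setT f) : {measure set T' -> \bar R} :=
  measure_function_pushforward__canonical__measure_function_Measure m mf.

Lemma lebesgue_measure_affine_preimage (R : realType) (c p : R) :
  (0 < p)%R -> forall A : set (measurableTypeR R), measurable A ->
  lebesgue_measure ((fun u : R => (u - c) / p)%R @^-1` A) =
  p%:E * lebesgue_measure A.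
Proof.
move=> p0 A mA; set psi := fun u : R => _.
have mpsi : measurable_fun setT (psi : measurableTypeR R -> measurableTypeR R).
  by apply: measurable_funM => //; apply: measurable_funB.
have pV0 : (0 <= p^-1)%R by rewrite invr_ge0 ltW.
pose m : {measure set (measurableTypeR R) -> \bar R} :=
  mscale (NngNum pV0) (image_measure (@lebesgue_measure R) mpsi).
have mE B : m B = (p^-1)%:E * lebesgue_measure (psi @^-1` B) by [].
have -> : lebesgue_measure A = m A.
  apply: (@lebesgue_measure_unique R m) => // _ [[a b] _ <-] /=.
  rewrite mE (_ : psi @^-1` _ = `](p * a + c)%R, (p * b + c)%R]%classic).
    rewrite !lebesgue_measure_itv/= !lte_fin ltrD2r ltr_pM2l//.
    case: ifPn => _; rewrite ?mule0// -!EFinD -EFinM; congr (_%:E).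
    by field; rewrite gt_eqF.
  apply/seteqP; split => u /=;
    by rewrite !in_itv/= /psi ltr_pdivlMr// ler_pdivrMr// => /andP[h1 h2]; lra.
by rewrite mE muleA -EFinM divff ?gt_eqF// mul1e.
Qed.

(** Normalizing a measure of total mass 1 does not change it. *)
Lemma measure_probability d (R : realType) (T : measurableType d)
    (q : {measure set T -> \bar R}) :
  q setT = 1 -> exists q' : probability T R, q' = q :> (set T -> \bar R).
Proof.
move=> qT; exists (mnormalize q (dirac point : probability T R)).
apply/funext => A; rewrite /= /mnormalize qT onee_eq0/=.
by rewrite invr1 mule1.
Qed.

Lemma eq_measure_nat (R : realType) (m m' : {measure set nat -> \bar R}) :
  (forall k, m [set k] = m' [set k]) -> forall B, m B = m' B.
Proof.
move=> mm' B; rewrite (_ : B = \bigcup_(k in B) [set k]); last first.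
  by apply/seteqP; split => [k Bk|k [j Bj ->]//]; exists k.
have tB : trivIset B (fun k : nat => [set k]).
  by move=> i j _ _ [k [/= -> ->]].
by rewrite !measure_bigcup//; apply: eq_eseriesr => k _.
Qed.

Section digits.
Variables (R : realType) (p : probability nat R).

Let p_fin (B : set nat) : p B \is a fin_num.
Proof. exact: fin_num_measure. Qed.

(* The endpoints of the subdivision of the unit interval. *)
Let c (k : nat) : R := fine (p [set j | (j < k)%N]).

Let cE k : (c k)%:E = p [set j | (j < k)%N].
Proof. by rewrite /c fineK// fin_num_measure. Qed.

Let c0 : c 0%N = 0%R.
Proof. by rewrite /c (_ : [set _ | _] = set0) ?measure0//; apply/seteqP; split. Qed.

Let cS k : c k.+1 = (c k + fine (p [set k]))%R.
Proof.
rewrite /c (_ : [set _ | _] = [set j | (j < k)%N] `|` [set k]); last first.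
  apply/seteqP; split => j /=; last by case=> [/ltnW|->]; rewrite ltnS.
  by rewrite ltnS leq_eqVlt => /orP[/eqP|]; [right|left].
rewrite measureU//; last first.
  by apply/seteqP; split => // j [/= + jk]; rewrite jk ltnn.
by rewrite fineD// fin_num_measure.
Qed.

Let p_ge0 k : (0 <= fine (p [set k]))%R.
Proof. exact: fine_ge0. Qed.

Let c_homo : {homo c : m n / (m <= n)%N >-> (m <= n)%R}.
Proof. by apply: homo_leq => // [x y z|k]; [exact: le_trans|rewrite cS lerDl]. Qed.

Let c_cvg : c @ \oo --> (1 : R)%R.
Proof.
have U1 : \bigcup_k [set j | (j < k)%N] = setT.
  by apply/seteqP; split => // j _; exists j.+1 => //=.
apply: fine_cvg; have -> : 1%:E = p (\bigcup_k [set j | (j < k)%N]).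
  by rewrite U1; exact/esym/probability_setT.
apply: nondecreasing_cvg_mu => // m n mn.
by apply/subsetPset => j /= jm; exact: leq_trans jm mn.
Qed.

(* [digit u] is the index of the interval containing [u], and [shift u] the
   position of [u] inside that interval, rescaled to the unit interval. *)
Let digit (u : R) : nat := xget 0%N [set k | (c k <= u < c k.+1)%R].
Let shift (u : R) : R := ((u - c (digit u)) / fine (p [set digit u]))%R.

Let digit_ex u : (0 <= u < 1)%R -> exists k, (c k <= u < c k.+1)%R.
Proof.
move=> /andP[u0 u1].
have ex : exists k, (u < c k)%R.
  have /(_ [set v | (u < v)%R]) := c_cvg.
  case; first exact: lt_nbhsr.
  by move=> k _ /(_ k (leqnn k)); exists k.
case: (ex_minnP ex) => -[|k]; first by rewrite c0 ltNge u0.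
move=> uk mk; exists k; rewrite uk andbT leNgt.
by apply/negP => /mk; rewrite ltnn.
Qed.

Let digit_unique u j k :
  (c j <= u < c j.+1)%R -> (c k <= u < c k.+1)%R -> j = k.
Proof.
move=> /andP[ju uj] /andP[ku uk]; apply/eqP; rewrite eqn_leq.
rewrite leqNgt (leqNgt k); apply/andP; split; apply/negP => /c_homo h.
  by have := le_lt_trans (le_trans h ju) uk; rewrite ltxx.
by have := le_lt_trans (le_trans h ku) uj; rewrite ltxx.
Qed.

Let digitP u k : (c k <= u < c k.+1)%R -> digit u = k.
Proof.
move=> uk; rewrite /digit; case: xgetP => [j _ /= /digit_unique|/(_ k)//].
exact.
Qed.

Let digitE k : `[0%R, 1%R[%classic `&` digit @^-1` [set k] =
  `[c k, c k.+1[%classic.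
Proof.
apply/seteqP; split => u /=; rewrite !in_itv/=.
  by case=> /digit_ex[j uj]; rewrite (digitP uj) => <-.
move=> uk; split; last exact: digitP.
have /andP[ku ku'] := uk.
rewrite (le_trans _ ku) -?c0 ?c_homo// (lt_le_trans ku')//.
rewrite -lee_fin cE -(@probability_setT _ _ _ p).
by apply: le_measure => //; rewrite inE.
Qed.

Let measurable_digit : measurable_fun setT (digit : measurableTypeR R -> nat).
Proof.
move=> _ B _; rewrite setTI.
rewrite (_ : digit @^-1` B = \bigcup_(k in B) `[c k, c k.+1[%classic `|`
  (if 0%N \in B then ~` \bigcup_k `[c k, c k.+1[%classic else set0)).
  apply: measurableU; first by apply: bigcup_measurable => k _.
  case: ifPn => _ //; apply: measurableC; exact: bigcup_measurable.
apply/seteqP; split => u.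
  have [[k _ /= uk] /= Bu|nu /= Bu] :=
      pselect ((\bigcup_k `[c k, c k.+1[%classic) u).
    left; exists k => //=; move: uk; rewrite in_itv/= => uk.
    by rewrite -(digitP uk).
  right; have d0 : digit u = 0%N.
    rewrite /digit; case: xgetP => // j _ /= uj; case: nu.
    by exists j => //=; rewrite in_itv.
  by rewrite mem_set -?d0.
case=> [[k Bk /=]|]; first by rewrite in_itv/= => /digitP ->.
case: ifPn => // /set_mem B0 nu /=.
rewrite (_ : digit u = 0%N)//.
rewrite /digit; case: xgetP => // j _ /= uj; case: nu.
    by exists j => //=; rewrite in_itv.
Qed.

Let measurable_shift :
  measurable_fun setT (shift : measurableTypeR R -> measurableTypeR R).
Proof.
have mnat (g : nat -> R) : measurable_fun setT (g \o digit).
  apply: (@measurableT_comp _ _ _ (measurableTypeR R) nat (measurableTypeR R)).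
    by [].
  exact: measurable_digit.
apply: measurable_funM; last exact: (mnat (fun k => (fine (p [set k]))^-1%R)).
by apply: measurable_funB => //; exact: (mnat c).
Qed.

Let unif : {measure set (measurableTypeR R) -> \bar R} :=
  mrestr (@lebesgue_measure R) (measurable_itv `[0%R, 1%R[).

Let unifE A : unif A = lebesgue_measure (A `&` `[0%R, 1%R[%classic).
Proof. by []. Qed.

Let unif_setT : unif setT = 1.
Proof. by rewrite unifE setTI lebesgue_measure_itv/= lte01 oppr0 adde0. Qed.

(* An interval of length [p {k}] is mapped affinely onto the unit interval, so
   that its Lebesgue measure is scaled by [p {k}]. An interval of length 0 is
   empty, which covers the values of null mass. *)
Let unif_step1 k (E : set (measurableTypeR R)) : measurable E ->
  unif (digit @^-1` [set k] `&` shift @^-1` E) = p [set k] * unif E.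
Proof.
move=> mE; rewrite !unifE setIAC [X in X `&` _]setIC digitE.
have [pk0|pk0] := eqVneq (fine (p [set k])) 0%R.
  rewrite cS pk0 addr0 set_itvco0// set0I measure0.
  by rewrite -(fineK (p_fin [set k]))// pk0 mul0e.
have pk : (0 < fine (p [set k]))%R by rewrite lt_def pk0 p_ge0.
rewrite -[p [set k]](fineK (p_fin [set k]))//.
rewrite -(lebesgue_measure_affine_preimage (c k) pk)//; last exact: measurableI.
congr (lebesgue_measure _); apply/seteqP; split => u /=; rewrite !in_itv/=.
  move=> [uk]; rewrite /shift (digitP uk) => Eu; split => //.
  rewrite ler_pdivlMr// mul0r ltr_pdivrMr// mul1r.
  by move: uk; rewrite cS => /andP[h1 h2]; apply/andP; split; lra.
rewrite ler_pdivlMr// mul0r ltr_pdivrMr// mul1r => -[Eu /andP[h1 h2]].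
have uk : (c k <= u < c k.+1)%R by rewrite cS; apply/andP; split; lra.
by split => //; rewrite /shift (digitP uk).
Qed.

Let unif_step (B : set nat) (E : set (measurableTypeR R)) : measurable E ->
  unif (digit @^-1` B `&` shift @^-1` E) = p B * unif E.
Proof.
move=> mE.
have msE : measurable (shift @^-1` E).
  by rewrite -[X in measurable X]setTI; exact: measurable_shift.
pose m1 : {measure set nat -> \bar R} :=
  image_measure (mrestr unif msE) measurable_digit.
have uE_ge0 : (0 <= fine (unif E))%R by exact: fine_ge0.
pose m2 : {measure set nat -> \bar R} := mscale (NngNum uE_ge0) p.
have uE : unif E \is a fin_num.
  rewrite ge0_fin_numE// (@le_lt_trans _ _ 1) ?ltry//.
  by rewrite -unif_setT; apply: (@le_measure _ _ _ unif); rewrite ?inE.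
have m2E A : m2 A = p A * unif E by rewrite -[unif E in RHS]fineK// muleC.
by rewrite -m2E; apply: (@eq_measure_nat R m1 m2 _ B) => k; rewrite m2E -unif_step1.
Qed.

Let digits (u : measurableTypeR R) : kpow nat := fun i => digit (iter i shift u).

Let measurable_digits : measurable_fun setT digits.
Proof.
apply: (@measurability _ _ (measurableTypeR R) (kpow nat) setT digits
  (@coord_cylinders _ nat)) => //.
move=> _ [_ [i [B mB ->]] <-]; rewrite setTI.
have mi : measurable_fun setT (iter i shift : measurableTypeR R -> measurableTypeR R).
  elim: i => [|i IH] /=; first exact: measurable_id.
  exact: (measurableT_comp measurable_shift IH).
rewrite -[X in measurable X]setTI.
exact: (measurableT_comp measurable_digit mi).
Qed.

Let unif_digits n (B : nat -> set nat) :
  unif [set u | forall i, (i < n)%N -> B i (digits u i)] = \prod_(i < n) p (B i).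
Proof.
elim: n B => [|n IH] B.
  by rewrite big_ord0 -unif_setT; congr (unif _); apply/seteqP; split.
rewrite big_ord_recl -(IH (fun i => B i.+1)) -unif_step.
  congr (unif _); apply/seteqP; split => u /=.
    move=> h; split => [|i i_n]; first exact: (h 0%N).
    by have := h i.+1 i_n; rewrite /digits iterSr.
  by move=> [h0 h] [|i] i_n //; have := h i i_n; rewrite /digits iterSr.
rewrite (_ : [set _ | _] = \bigcap_(i in [set i | (i < n)%N])
    (digits @^-1` [set x | B i.+1 (x i)])).
  apply: bigcap_measurableType => i _; rewrite -[X in measurable X]setTI.
  apply: measurable_digits => //; apply: sub_sigma_algebra.
  by exists i; exists (B i.+1).
by apply/seteqP; split.
Qed.

(** The law of the successive digits of a uniform point. By [unif_step] the first
    digit is independent of the shifted point, which is again uniform. *)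
Lemma iid_exists : exists q : probability (kpow nat) R, is_iid_measure p q.
Proof.
pose q : {measure set (kpow nat) -> \bar R} := image_measure unif measurable_digits.
have [q' q'E] := @measure_probability _ _ _ q unif_setT.
by exists q' => n B _; rewrite q'E; exact: unif_digits.
Qed.

End digits.

(** * Empirical frequencies of a sequence of natural numbers *)

Section freq_theory.
Variable R : realType.
Implicit Types (x : nat -> nat) (T : set nat).

Lemma freqE x T n : freq R x T n = (n%:R^-1 * \sum_(i < n) \1_T (x i))%R.
Proof.
rewrite /freq mulrC -sum1_card natr_sum; congr (_ * _)%R.
rewrite big_mkcond/=; apply: eq_bigr => i _.
by rewrite indicE inE; case: ifPn.
Qed.

Lemma freq_ge0 x T n : (0 <= freq R x T n)%R.
Proof. by rewrite divr_ge0. Qed.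

Lemma freqS x T T' n : T `<=` T' -> (freq R x T n <= freq R x T' n)%R.
Proof.
move=> TT'; rewrite !freqE ler_wpM2l// ler_sum// => i _.
rewrite !indicE ler_nat.
by case: (boolP (x i \in T)) => // /set_mem/TT'/mem_set ->.
Qed.

Lemma freqU x T T' n : T `&` T' = set0 ->
  (freq R x (T `|` T') n = freq R x T n + freq R x T' n)%R.
Proof.
move=> TT'; rewrite !freqE -mulrDr -big_split/=; congr (_ * _)%R.
apply: eq_bigr => i _; rewrite !indicE in_setU.
case: (boolP (x i \in T)) => [/set_mem xT|_]; last by rewrite add0r.
case: (boolP (x i \in T')) => [/set_mem xT'|_]; last by rewrite addr0.
by have : (T `&` T') (x i) by []; rewrite TT'.
Qed.

Lemma freq_setT x n : (0 < n)%N -> freq R x setT n = 1%R.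
Proof.
move=> n0; rewrite freqE (eq_bigr (fun=> 1%R)); last by move=> i _; rewrite indicT.
by rewrite sumr_const card_ord mulVf// pnatr_eq0 -lt0n.
Qed.

Lemma freq_le1 x T n : (freq R x T n <= 1)%R.
Proof.
case: n => [|n]; first by rewrite /freq invr0 mulr0.
by rewrite -(freq_setT x (ltn0Sn n)); exact: freqS.
Qed.

Lemma freq0 x n : freq R x set0 n = 0%R.
Proof. by rewrite freqE big1 ?mulr0// => i _; rewrite indic0. Qed.

Lemma freqC x T n : (0 < n)%N -> freq R x (~` T) n = (1 - freq R x T n)%R.
Proof.
move=> n0; apply/eqP; rewrite eq_sym subr_eq -freqU ?setICl//.
by rewrite setUCl freq_setT.
Qed.

Lemma freq_gt x t n : (0 < n)%N ->
  freq R x [set m | (t < m)%N] n = (1 - freq R x [set m | (m <= t)%N] n)%R.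
Proof.
move=> n0; rewrite -freqC//; congr freq.
by apply/seteqP; split => m /=; rewrite ltnNge => /negP.
Qed.

(** A point beyond the support of [s] is fixed, hence is the image of itself only. *)
Lemma finite_permutation_stable (s : nat -> nat) : finite_permutation s ->
  \forall n \near \oo, forall i, (i < n)%N -> (s i < n)%N.
Proof.
move=> [/bij_inj sI /finite_seqP[r sr]].
exists (\max_(i <- r) i).+1 => // n /= rn i i_n.
rewrite ltnNge; apply/negP => nsi.
have : s (s i) = s i.
  apply/eqP; apply/negPn/negP => ssi.
  have : [set` r] (s i) by rewrite -sr.
  move=> /= sir; have : (s i <= \max_(i <- r) i)%N.
    by rewrite (big_rem _ sir)/= leq_maxl.
  by rewrite leqNgt => /negP; apply; exact: leq_trans rn nsi.
by move/sI => si; move: nsi; rewrite si leqNgt i_n.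
Qed.

(** Once [n] exceeds the support of [s], the first [n] terms of the two
    sequences are the same up to order. *)
Lemma freq_permute x (s : nat -> nat) : finite_permutation s ->
  \forall n \near \oo, forall T,
    freq R (fun i => x (s i)) T n = freq R x T n.
Proof.
move=> fs; have := finite_permutation_stable fs.
apply: filterS => n sn T; rewrite !freqE; congr (_ * _)%R.
rewrite -(big_mkord xpredT (fun i => \1_T (x (s i)))).
rewrite -(big_mkord xpredT (fun i => \1_T (x i))) /index_iota subn0.
rewrite -(big_map s xpredT (fun i => \1_T (x i))); apply: perm_big.
have sI := bij_inj (proj1 fs).
have us : uniq (map s (iota 0 n)) by rewrite map_inj_uniq// iota_uniq.
apply: uniq_perm => //; first exact: iota_uniq.
have /= sub : {subset map s (iota 0 n) <= iota 0 n}.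
  by move=> _ /mapP[i + ->]; rewrite !mem_iota/= !add0n; exact: sn.
have sz : (size (iota 0 n) <= size (map s (iota 0 n)))%N by rewrite size_map.
by have [_ +] := uniq_min_size us sub sz.
Qed.

Lemma uniform_cdf_limit_permute x (s : nat -> nat) : finite_permutation s ->
  uniform_cdf_limit R (fun i => x (s i)) <-> uniform_cdf_limit R x.
Proof.
move=> /(freq_permute x) xs; split => /uniform_cdf_limitP[F HF];
  apply/uniform_cdf_limitP; exists F => e /HF;
  by apply: filterS2 xs => n xs He t; rewrite ?xs// -xs.
Qed.

(** * The sequences whose distribution functions converge uniformly *)

(** A Cauchy criterion involving only countably many conditions, each on finitely
    many terms: it makes the domain measurable. *)
Definition cdf_cauchy x := forall k, exists N, forall n m t,
  (N <= n)%N -> (N <= m)%N ->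
  (`|freq R x [set j | (j <= t)%N] n - freq R x [set j | (j <= t)%N] m| <=
   k.+1%:R^-1)%R.

Lemma uniform_cdf_limit_cauchy x : uniform_cdf_limit R x <-> cdf_cauchy x.
Proof.
split => [/uniform_cdf_limitP[F HF] k|xC].
  have /HF[N _ HN] : (0 < k.+1%:R^-1 / 2 :> R)%R by rewrite divr_gt0.
  exists N => n m t Nn Nm.
  have /= := HN n Nn t; have /= := HN m Nm t; set a := freq _ _ _ n.
  set b := freq _ _ _ m => h1 h2; rewrite [leRHS]splitr.
  rewrite (_ : a - b = (F t - b) - (F t - a))%R; last by ring.
  by rewrite (le_trans (ler_normB _ _))// ltW// ltrD.
apply/uniform_cdf_limitP.
have ex_small (e : R) : (0 < e)%R -> exists k, (k.+1%:R^-1 < e)%R.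
  move=> e0; have [k _ hk] := near_infty_natSinv_lt (PosNum e0).
  by exists k; exact: (hk k (leqnn k)).
have cF t : cvgn (freq R x [set j | (j <= t)%N]).
  apply/cauchy_cvgP/cauchy_exP => e /= /ex_small[k ke].
  have [N HN] := xC k; exists (freq R x [set j | (j <= t)%N] N).
  exists N => // n /= Nn; rewrite /ball/=.
  by rewrite (le_lt_trans _ ke)// HN.
exists (fun t => limn (freq R x [set j | (j <= t)%N])) => e /ex_small[k ke].
have [N HN] := xC k; exists N => // n /= Nn t.
apply: le_lt_trans ke; set a := freq _ _ _ n.
have : (`|freq R x [set j | (j <= t)%N] m - a| @[m --> \oo] -->
    `|limn (freq R x [set j | (j <= t)%N]) - a|)%R.
  by apply: cvg_norm; apply: cvgB; [exact: cF|exact: cvg_cst].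
move=> /cvg_lim <- //; apply: limr_le.
  by apply: is_cvg_norm; apply: is_cvgB; [exact: cF|exact: is_cvg_cst].
by exists N => // m /= Nm; exact: HN.
Qed.

Definition tight_freq x := forall e : R, (0 < e)%R -> exists t,
  \forall n \near \oo, (freq R x [set m | (t < m)%N] n < e)%R.

(** A single empirical distribution function reaches 1 at the maximum of finitely
    many terms, and all later ones are uniformly close to it. *)
Lemma uniform_cdf_limit_tight x : uniform_cdf_limit R x -> tight_freq x.
Proof.
move=> /uniform_cdf_limitP[F HF] e e0.
have /HF[N _ HN] : (0 < e / 2)%R by rewrite divr_gt0.
pose t := (\max_(i < N.+1) x i)%N.
exists t; exists N.+1 => // n /= Nn; rewrite freq_gt ?(leq_trans _ Nn)//.
have /= := HN n (ltnW Nn) t; have /= := HN N.+1 (leqnSn N) t.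
rewrite (_ : freq _ _ _ N.+1 = 1)%R.
  by rewrite !ltr_norml => /andP[h1 h2] /andP[h3 h4]; lra.
rewrite -(freq_setT x (ltn0Sn N)) !freqE; congr (_ * _)%R.
apply: eq_bigr => i _; rewrite indicT indicE mem_set//=.
exact: (leq_bigmax i).
Qed.

(** Past the bound given by tightness, all distribution functions lie between
    [1 - e / 2] and 1 by monotonicity; before it there are finitely many [t]. *)
Lemma tight_uniform_cdf_limit x :
  (forall t, cvgn (freq R x [set m | (m <= t)%N])) -> tight_freq x ->
  uniform_cdf_limit R x.
Proof.
move=> cF tx; apply/uniform_cdf_limitP.
set F := fun t => limn (freq R x [set m | (m <= t)%N]).
exists F => e e0; have e20 : (0 < e / 2)%R by rewrite divr_gt0.
have [t [N _ HN]] := tx _ e20.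
have tail u n : (t <= u)%N -> (N.+1 <= n)%N ->
    (1 - e / 2 <= freq R x [set m | (m <= u)%N] n <= 1)%R.
  move=> tu Nn; rewrite freq_le1 andbT.
  have := HN n (ltnW Nn); rewrite /= freq_gt ?(leq_trans _ Nn)// => h.
  rewrite (@le_trans _ _ (freq R x [set m | (m <= t)%N] n))//.
    by rewrite lerBlDr -lerBlDl ltW.
  by apply: freqS => m /= mt; exact: leq_trans mt tu.
have tailF u : (t <= u)%N -> (1 - e / 2 <= F u <= 1)%R.
  move=> tu; apply/andP; split.
    by apply: limr_ge => //; exists N.+1 => // n /= /(tail u _ tu)/andP[].
  by apply: limr_le => //; exists N.+1 => // n /= /(tail u _ tu)/andP[].
have head k : \forall n \near \oo, forall u, (u < k)%N ->
    (`|F u - freq R x [set m | (m <= u)%N] n| < e)%R.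
  elim: k => [|k IH]; first by near=> n.
  have /cvgrPdist_lt/(_ e e0) Hk : freq R x [set m | (m <= k)%N] @ \oo --> F k.
    exact: cF.
  near=> n => u; rewrite ltnS leq_eqVlt => /orP[/eqP ->|uk].
    by near: n; exact: Hk.
  by move: u uk; near: n; exact: IH.
near=> n => u; have [ut|tu] := ltnP u t.
  by move: u ut; near: n; exact: head.
have /(tail u _ tu) /andP[h1 h2] : (N.+1 <= n)%N by near: n; exact: nbhs_infty_ge.
by have /andP[h3 h4] := tailF u tu; rewrite ltr_norml; apply/andP; split; lra.
Unshelve. all: by end_near. Qed.

End freq_theory.

(** * The limiting frequencies form a probability measure *)

Section limit_measure.
Variable R : realType.
Implicit Types (x : nat -> nat) (T : set nat).

Lemma cvgn_approx (u : nat -> R) :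
  (forall e : R, (0 < e)%R -> exists2 v : nat -> R, cvgn v &
    \forall n \near \oo, (`|v n - u n| <= e)%R) -> cvgn u.
Proof.
move=> uP; apply/cauchy_cvgP/cauchy_exP => e e0 /=.
have e20 : (0 < e / 2)%R by rewrite divr_gt0.
have [v cv uv] := uP _ e20; exists (limn v).
have /cvgrPdist_lt/(_ _ e20) vl : v @ \oo --> limn v by [].
near=> n; rewrite /ball/= (splitr e) (_ : _ - _ = (limn v - v n) + (v n - u n))%R.
  rewrite (le_lt_trans (ler_normD _ _))// ltr_leD//; near: n; first exact: vl.
  exact: uv.
by rewrite addrA subrK.
Unshelve. all: by end_near. Qed.

Let setI_leS T t : T `&` [set m | (m <= t.+1)%N] =
  (T `&` [set m | (m <= t)%N]) `|` (T `&` [set t.+1]).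
Proof.
apply/seteqP; split => m /=; last first.
  by case=> [[Tm /leqW]|[Tm mt]]; split => //; rewrite mt.
by rewrite leq_eqVlt => -[Tm /orP[/eqP mt|mt]]; [right|left].
Qed.

Let disj_leS T t :
  (T `&` [set m | (m <= t)%N]) `&` (T `&` [set t.+1]) = set0.
Proof. by apply/seteqP; split => // m /= [[_ + [_ mt]]]; rewrite mt ltnn. Qed.

(** Finite sets inherit convergence from the distribution function, and tightness
    makes the frequency of [T] uniformly close to that of a finite part of [T]. *)
Lemma cvgn_freq x T : uniform_cdf_limit R x -> cvgn (freq R x T).
Proof.
move=> Dx; have cF t : cvgn (freq R x [set m | (m <= t)%N]).
  have /uniform_cdf_limitP[F HF] := Dx.
  apply/cvg_ex; exists (F t); apply/cvgrPdist_lt => e /HF.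
  by apply: filterS => n /(_ t).
have c1 t : cvgn (freq R x [set t]).
  case: t => [|t].
    rewrite (_ : [set 0%N] = [set m | (m <= 0)%N])//.
    by apply/seteqP; split => m /=; rewrite leqn0 => /eqP.
  rewrite (_ : freq R x [set t.+1] = (freq R x [set m | (m <= t.+1)%N] \-
    freq R x [set m | (m <= t)%N])%R); first exact: is_cvgB.
  apply/funext => n /=; apply/eqP; rewrite eq_sym subr_eq; apply/eqP.
  have := setI_leS setT t; rewrite !setTI => ->.
  by rewrite addrC; apply: freqU; have := disj_leS setT t; rewrite !setTI.
have cT t : cvgn (freq R x (T `&` [set m | (m <= t)%N])).
  have c1T k : cvgn (freq R x (T `&` [set k])).
    have [Tk|nTk] := pselect (T k).
      rewrite (_ : T `&` [set k] = [set k])//.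
      by apply/seteqP; split => [m []//|m /= ->].
    rewrite (_ : T `&` [set k] = set0).
      rewrite (_ : freq _ _ _ = cst 0%R); first exact: is_cvg_cst.
      by apply/funext => n; rewrite freq0.
    by apply/seteqP; split => // m /= [+ mk]; rewrite mk.
  elim: t => [|t IH].
    rewrite (_ : [set m | (m <= 0)%N] = [set 0%N])//.
    by apply/seteqP; split => m /=; rewrite leqn0 => /eqP.
  rewrite setI_leS (_ : freq _ _ _ = (freq R x (T `&` [set m | (m <= t)%N]) \+
    freq R x (T `&` [set t.+1]))%R); first exact: is_cvgD.
  by apply/funext => n /=; rewrite freqU.
apply: cvgn_approx => e e0; have [t ht] := uniform_cdf_limit_tight Dx e0.
exists (freq R x (T `&` [set m | (m <= t)%N])) => //.
apply: filterS ht => n hn.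
rewrite (_ : freq R x T n = freq R x (T `&` [set m | (m <= t)%N]) n +
   freq R x (T `&` [set m | (t < m)%N]) n)%R.
  rewrite opprD addNKr normrN ger0_norm ?freq_ge0//.
  by rewrite ltW// (le_lt_trans _ hn)// freqS.
rewrite -freqU; last first.
  by apply/seteqP; split => // m /= [[_ +] [_]]; rewrite leqNgt => /negP.
rewrite -setIUr; congr freq; apply/seteqP; split => [m Tm|m []//].
by split => //=; have [?|?] := leqP m t; [left|right].
Qed.

Definition lim_freq x T : R := limn (freq R x T).

Lemma lim_freq_ge0 x T : uniform_cdf_limit R x -> (0 <= lim_freq x T)%R.
Proof.
move=> /cvgn_freq cx; apply: limr_ge => //; near=> n.
exact: freq_ge0.
Unshelve. all: by end_near. Qed.

Lemma lim_freqU x T T' : uniform_cdf_limit R x -> T `&` T' = set0 ->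
  lim_freq x (T `|` T') = (lim_freq x T + lim_freq x T')%R.
Proof.
move=> Dx TT'; apply/cvg_lim => //.
rewrite (_ : freq _ _ _ = (freq R x T \+ freq R x T')%R).
  by apply: cvgD; exact: cvgn_freq.
by apply/funext => n; rewrite freqU.
Qed.

Lemma lim_freq_setT x : lim_freq x setT = 1%R.
Proof.
apply/cvg_lim => //; apply: cvg_near_cst; exists 1%N => // n /= n0.
exact: freq_setT.
Qed.

Lemma lim_freq0 x : lim_freq x set0 = 0%R.
Proof.
rewrite /lim_freq (_ : freq _ _ _ = cst 0%R) ?lim_cst//.
by apply/funext => n; rewrite freq0.
Qed.

Lemma lim_freq_bigcup_lt x (F : (set nat)^nat) n :
  uniform_cdf_limit R x -> trivIset setT F ->
  lim_freq x (\bigcup_(i in [set i | (i < n)%N]) F i) =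
  (\sum_(0 <= i < n) lim_freq x (F i))%R.
Proof.
move=> Dx tF; elim: n => [|n IH].
  rewrite big_geq// (_ : bigcup _ _ = set0) ?lim_freq0//.
  by apply/seteqP; split => // m [].
rewrite big_nat_recr//= -IH -lim_freqU//.
  congr lim_freq; apply/seteqP; split => m.
    move=> [i /=]; rewrite ltnS leq_eqVlt => /orP[/eqP ->|i_n] Fm; first by right.
    by left; exists i.
  by case=> [[i /= i_n Fm]|Fm]; [exists i => //=; exact: ltnW|exists n => /=].
apply/seteqP; split => // m [[i /= i_n Fim] Fnm].
have := tF i n I I; move=> h; have : i = n by apply: h; exists m.
by move=> E; move: i_n; rewrite E ltnn.
Qed.

(** Each number belongs to at most one of the sets. *)
Lemma trivIset_eventually_gt (F : (set nat)^nat) t : trivIset setT F ->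
  exists N, forall i m, (N <= i)%N -> (m <= t)%N -> ~ F i m.
Proof.
move=> tF; have aux m : exists N, forall i, (N <= i)%N -> ~ F i m.
  have [[j Fjm]|nF] := pselect (exists j, F j m).
    exists j.+1 => i ji Fim; have := tF i j I I; move=> h.
    have E : i = j by apply: h; exists m.
    by move: ji; rewrite E ltnn.
  by exists 0%N => i _ Fim; apply: nF; exists i.
elim: t => [|t [N HN]].
  have [N HN] := aux 0%N; exists N => i m Ni.
  by rewrite leqn0 => /eqP ->; exact: HN.
have [N' HN'] := aux t.+1; exists (maxn N N') => i m.
rewrite geq_max => /andP[Ni N'i]; rewrite leq_eqVlt => /orP[/eqP ->|].
  exact: HN'.
by rewrite ltnS; exact: HN.
Qed.

(** By finite additivity the error is the limiting frequency of the union of the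
    remaining sets; these avoid [{m | m <= t}], so tightness bounds it. *)
Lemma lim_freq_sigma_additive x : uniform_cdf_limit R x ->
  semi_sigma_additive (fun T => (lim_freq x T)%:E).
Proof.
move=> Dx F _ tF _.
under eq_fun do rewrite sumEFin -lim_freq_bigcup_lt//.
apply: cvg_EFin; first by near=> n.
apply/cvgrPdist_le => e e0 /=.
have [t ht] := uniform_cdf_limit_tight Dx e0.
have [N HN] := trivIset_eventually_gt t tF.
exists N => // n /= Nn.
rewrite (_ : \bigcup_n0 F n0 = \bigcup_(i in [set i | (i < n)%N]) F i `|`
   \bigcup_(i in [set i | (n <= i)%N]) F i).
  rewrite lim_freqU//; last first.
    apply/seteqP; split => // m [[i /= i_n Fim] [j /= nj Fjm]].
    have := tF i j I I; move=> h; have E : i = j by apply: h; exists m.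
    by move: i_n; rewrite E ltnNge nj.
  rewrite addrC addKr ger0_norm ?lim_freq_ge0//.
  apply: limr_le; first exact: cvgn_freq.
  apply: filterS ht => k /ltW; apply: le_trans; apply: freqS => m [i /= ni Fim].
  rewrite ltnNge; apply/negP => mt.
  exact: (HN i m (leq_trans Nn ni) mt).
apply/seteqP; split => m; last by move=> [[i _ Fim]|[i _ Fim]]; exists i.
by move=> [i _ Fim]; have [i_n|ni] := ltnP i n; [left|right]; exists i.
Unshelve. all: by end_near. Qed.

End limit_measure.

(** * The empirical sampling kernel *)

Section sampling_kernel.
Variable R : realType.

Lemma measurable_coord d (X : measurableType d) i :
  measurable_fun setT (fun x : kpow X => x i).
Proof.
move=> _ B mB; rewrite setTI; apply: sub_sigma_algebra.
by exists i; exists B.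
Qed.

Lemma measurable_freq T n :
  measurable_fun setT (fun x : kpow nat => freq R x T n).
Proof.
under eq_fun do rewrite freqE; apply: measurable_funM => //.
apply: measurable_sum => i.
apply: (@measurableT_comp _ _ _ (kpow nat) nat R (\1_T : nat -> R)) => //.
exact: measurable_coord.
Qed.

Lemma measurable_uniform_cdf_limit :
  measurable [set x : kpow nat | uniform_cdf_limit R x].
Proof.
pose S k n m t := [set x : kpow nat | (`|freq R x [set j | (j <= t)%N] n -
  freq R x [set j | (j <= t)%N] m| <= k.+1%:R^-1)%R].
rewrite (_ : [set _ | _] = \bigcap_k \bigcup_N \bigcap_(n in [set n | (N <= n)%N])
   \bigcap_(m in [set m | (N <= m)%N]) \bigcap_t S k n m t).
  apply: bigcap_measurableType => k _; apply: bigcup_measurable => N _.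
  apply: bigcap_measurableType => n _; apply: bigcap_measurableType => m _.
  apply: bigcap_measurableType => t _; rewrite /S.
  rewrite -[X in measurable X]setTI.
  apply: measurable_fun_le => //; apply: measurableT_comp => //.
  by apply: measurable_funB; exact: measurable_freq.
apply/seteqP; split => x.
  move/uniform_cdf_limit_cauchy => xC k _; have [N HN] := xC k.
  by exists N => // n Nn m Nm t _; exact: HN.
move=> xS; apply/uniform_cdf_limit_cauchy => k.
have [N _ HN] := xS k I; exists N => n m t Nn Nm; exact: HN.
Qed.

(** The Dirac mass off the domain makes this a probability measure depending
    measurably on an arbitrary sequence, so that it can be integrated against laws
    on the whole sequence space. *)
Definition limit_law (x : kpow nat) (T : set nat) : \bar R :=
  if `[< uniform_cdf_limit R x >] then (lim_freq R x T)%:E else \d_0%N T.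

Let limit_law0 x : limit_law x set0 = 0.
Proof. by rewrite /limit_law; case: ifP => _; rewrite ?lim_freq0// measure0. Qed.

Let limit_law_ge0 x T : 0 <= limit_law x T.
Proof.
rewrite /limit_law; case: asboolP => Dx //.
by rewrite lee_fin lim_freq_ge0.
Qed.

Let limit_law_sigma_additive x : semi_sigma_additive (limit_law x).
Proof.
rewrite /limit_law; case: asboolP => Dx; first exact: lim_freq_sigma_additive.
exact: measure_semi_sigma_additive.
Qed.

HB.instance Definition _ x := isMeasure.Build _ _ R (limit_law x)
  (limit_law0 x) (limit_law_ge0 x) (@limit_law_sigma_additive x).

Let limit_law_setT x : limit_law x setT = 1.
Proof.
by rewrite /limit_law; case: ifP => _; rewrite ?lim_freq_setT// diracT.
Qed.

HB.instance Definition _ x := Measure_isProbability.Build _ _ R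
  (limit_law x) (limit_law_setT x).

Lemma limit_lawE (x : kpow nat) T : uniform_cdf_limit R x ->
  limit_law x T = (lim_freq R x T)%:E.
Proof. by move=> Dx; rewrite /limit_law asboolT. Qed.

Lemma freq_cvg_limit_law (x : kpow nat) T : uniform_cdf_limit R x ->
  (freq R x T n)%:E @[n --> \oo] --> limit_law x T.
Proof.
move=> Dx; rewrite limit_lawE//; apply: cvg_EFin; first by near=> n.
exact: cvgn_freq.
Unshelve. all: by end_near. Qed.

Lemma measurable_limit_law T : measurable_fun setT (limit_law ^~ T).
Proof.
have DE : (fun x : kpow nat => `[< uniform_cdf_limit R x >]) @^-1` [set true] =
    [set x : kpow nat | uniform_cdf_limit R x].
  by apply/seteqP; split => x /=; [move/asboolP|move=> ?; apply/asboolP].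
apply: measurable_fun_if => //.
- apply: (measurable_fun_bool true); rewrite setTI DE.
  exact: measurable_uniform_cdf_limit.
- rewrite setTI DE; apply/measurable_EFinP.
  apply: (@measurable_fun_cvg _ _ _ _ (fun n (x : kpow nat) => freq R x T n)) => [n|x Dx].
    by apply: measurable_funTS; exact: measurable_freq.
  exact: cvgn_freq.
Qed.

End sampling_kernel.

(** * Powers of a kernel *)

(** The sets on which [is_iid_measure] prescribes the measure. *)
Definition head_cylinders d (X : measurableType d) : set (set (kpow X)) :=
  [set C | exists n (B : nat -> set X), (forall i, measurable (B i)) /\
    C = [set x | forall i, (i < n)%N -> B i (x i)]].
Arguments head_cylinders {d} X.

Lemma measurable_head_cylinder d (X : measurableType d) C :
  head_cylinders X C -> measurable C.
Proof.
move=> [n [B [mB ->]]].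
rewrite (_ : [set _ | _] =
    \bigcap_(i in [set i | (i < n)%N]) (fun x : kpow X => x i) @^-1` B i).
  apply: bigcap_measurableType => i _; rewrite -[X in measurable X]setTI.
  by apply: measurable_coord.
by apply/seteqP; split.
Qed.

Lemma head_cylinders_setI d (X : measurableType d) :
  setI_closed (head_cylinders X).
Proof.
move=> _ _ [n [B [mB ->]]] [m [B' [mB' ->]]].
exists (maxn n m), (fun i => (if (i < n)%N then B i else setT) `&`
  (if (i < m)%N then B' i else setT)); split => [i|].
  by apply: measurableI; case: ifP.
apply/seteqP; split => [x [Bx B'x] i _|x h].
  by split; case: ifP => // im; [exact: Bx|exact: B'x].
by split => i im; have := h i; rewrite leq_max im ?orbT => /(_ isT) [].
Qed.

Lemma kpow_head_cylinders d (X : measurableType d) :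
  @measurable _ (kpow X) = <<s head_cylinders X >>.
Proof.
apply/seteqP; split; last first.
  apply: smallest_sub; first exact: sigma_algebra_measurable.
  exact: measurable_head_cylinder.
apply: smallest_sub; first exact: smallest_sigma_algebra.
move=> _ [i [B mB ->]]; apply: sub_sigma_algebra.
exists i.+1, (fun j => if j == i then B else setT); split => [j|].
  by case: ifP.
apply/seteqP; split => [x Bx j _|x /(_ i (ltnSn i))]; last by rewrite eqxx.
by case: eqP => [->|].
Qed.

(** On cylinders the measure is a finite product of measurable functions; the
    sets with measurable evaluation form a Dynkin system. *)
Lemma measurable_iid_measure d d' (R : realType) (T : measurableType d)
    (X : measurableType d') (p : T -> probability X R)
    (q : T -> probability (kpow X) R) :
  (forall x, is_iid_measure (p x) (q x)) ->
  (forall B, measurable B -> measurable_fun setT (fun x => p x B)) ->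
  forall S, measurable S -> measurable_fun setT (fun x => q x S).
Proof.
move=> pq mp S mS.
apply: (@dynkin_induction _ (kpow X) (head_cylinders X)
  (fun S => measurable_fun setT (fun x => q x S))).
- exact: kpow_head_cylinders.
- exact: head_cylinders_setI.
- rewrite (_ : (fun _ => _) = cst 1) //.
  by apply/funext => x; exact: probability_setT.
- move=> _ [n [B [mB ->]]].
  under eq_fun do rewrite pq//.
  rewrite (_ : (fun _ => _) = (fun x => (\prod_(i < n) fine (p x (B i)))%:E)).
    apply/measurable_EFinP; apply: measurable_prod => i _.
    apply: (measurableT_comp (fine_measurable measurableT)); exact: mp.
  apply/funext => x; rewrite -prodEFin; apply: eq_bigr => i _.
  by rewrite fineK// fin_num_measure.
- move=> A mA mqA.
  under eq_fun do rewrite probability_setC//.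
  by apply: emeasurable_funB.
- move=> F mF tF mqF.
  rewrite (_ : (fun _ => _) = (fun x => \sum_(0 <= k <oo) q x (F k))).
    exact: ge0_emeasurable_sum.
  apply/funext => x; apply/esym/cvg_lim => //.
  by apply: measure_semi_sigma_additive => //; exact: bigcup_measurable.
- by rewrite -kpow_head_cylinders.
Qed.

Section sampling_pkernel.
Variable R : realType.

Definition sampling : pkernel R (kpow nat) nat :=
  @PKernel R _ _ (kpow nat) nat [set x : kpow nat | uniform_cdf_limit R x]
    (fun x => limit_law R x : subprobability nat R)
    (measurable_uniform_cdf_limit R)
    (fun T _ => measurable_funTS (@measurable_limit_law R T))
    (fun x _ => probability_setT (limit_law R x)).

Definition limit_law_iid (x : kpow nat) : probability (kpow nat) R :=
  projT1 (cid (iid_exists (limit_law R x))).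

Lemma limit_law_iidP x : is_iid_measure (limit_law R x) (limit_law_iid x).
Proof. by rewrite /limit_law_iid; case: cid. Qed.

Let measurable_limit_law_iid S : measurable S ->
  measurable_fun [set x : kpow nat | uniform_cdf_limit R x] (fun x => limit_law_iid x S).
Proof.
move=> mS; apply: measurable_funTS.
apply: (measurable_iid_measure limit_law_iidP) => // B _.
exact: measurable_limit_law.
Qed.

Definition samplingN : pkernel R (kpow nat) (kpow nat) :=
  @PKernel R _ _ (kpow nat) (kpow nat) [set x : kpow nat | uniform_cdf_limit R x]
    (fun x => limit_law_iid x : subprobability (kpow nat) R)
    (measurable_uniform_cdf_limit R)
    measurable_limit_law_iid
    (fun x _ => probability_setT (limit_law_iid x)).

Lemma is_kpower_samplingN : is_kpower sampling samplingN.
Proof. by split => // x _; exact: limit_law_iidP. Qed.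

End sampling_pkernel.

(** * Permutation invariance *)

Lemma limit_law_permute (R : realType) (s : nat -> nat) (x : kpow nat) T :
  finite_permutation s -> limit_law R (permute s x) T = limit_law R x T.
Proof.
move=> fs; have Dxs := uniform_cdf_limit_permute R x fs.
have [Dx|nDx] := pselect (uniform_cdf_limit R x); last first.
  by rewrite /limit_law !asboolF// => /Dxs.
rewrite !limit_lawE//; last exact/Dxs.
congr (_%:E); apply/cvg_lim => //.
have := @cvgn_freq R x T Dx; apply: cvg_trans; apply: near_eq_cvg.
by apply: filterS (freq_permute R x fs) => n /(_ T).
Qed.

Lemma sampling_permute (R : realType) s : finite_permutation s ->
  pk_eq (pk_comp (sampling R) (pk_permute R nat s)) (sampling R).
Proof.
move=> fs.
have Dxs (x : kpow nat) := uniform_cdf_limit_permute R x fs.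
split.
  apply/seteqP; split => x /=; rewrite /pcomp_dom/= diracE.
    move=> [_]; case: (boolP (_ \in _)) => [/set_mem xD _|_ /eqP].
      exact/Dxs.
    by rewrite eqe eq_sym oner_eq0.
  by move=> Dx; split => //; rewrite mem_set//; exact/Dxs.
move=> x [_ /=]; rewrite diracE; case: (boolP (_ \in _)) => [xsD _|_ /eqP].
  move=> S _.
  rewrite /= /pcomp_ker/= integral_dirac//.
  - by rewrite diracE xsD mul1e; exact: limit_law_permute.
  - exact: measurable_uniform_cdf_limit.
  - by apply: measurable_funTS; exact: measurable_limit_law.
by rewrite eqe eq_sym oner_eq0.
Qed.

(** * Expectations of bounded measurable functions *)

Section bounded_expectation.
Context d (R : realType) (T : measurableType d).
Local Open Scope ring_scope.

(** All functions integrated below are of this kind; the class is closed under the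
    ring operations, which spares integrability side conditions. *)
Definition bounded_measurable (g : T -> R) :=
  measurable_fun setT g /\ exists M, forall z, `|g z| <= M.

Lemma bounded_measurable_cst r : bounded_measurable (cst r).
Proof. by split => //; exists `|r|. Qed.

Lemma bounded_measurableD g h : bounded_measurable g -> bounded_measurable h ->
  bounded_measurable (g \+ h).
Proof.
move=> [mg [M gM]] [mh [N hN]]; split; first exact: measurable_funD.
by exists (M + N) => z; rewrite (le_trans (ler_normD _ _))// lerD.
Qed.

Lemma bounded_measurableM g h : bounded_measurable g -> bounded_measurable h ->
  bounded_measurable (g \* h).
Proof.
move=> [mg [M gM]] [mh [N hN]]; split; first exact: measurable_funM.
by exists (M * N) => z; rewrite normrM ler_pM.
Qed.

Lemma bounded_measurableZ r g : bounded_measurable g ->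
  bounded_measurable (fun z => r * g z).
Proof. exact: bounded_measurableM (bounded_measurable_cst r). Qed.

Lemma bounded_measurable_sum (I : Type) (s : seq I) (P : pred I)
    (g : I -> T -> R) : (forall i, bounded_measurable (g i)) ->
  bounded_measurable (fun z => \sum_(i <- s | P i) g i z).
Proof.
move=> bg; elim: s => [|i s IH].
  by under eq_fun do rewrite big_nil; exact: bounded_measurable_cst.
under eq_fun do rewrite big_cons.
by case: (P i) => //; exact: bounded_measurableD.
Qed.

Lemma bounded_measurable_prod (I : Type) (s : seq I) (P : pred I)
    (g : I -> T -> R) : (forall i, bounded_measurable (g i)) ->
  bounded_measurable (fun z => \prod_(i <- s | P i) g i z).
Proof.
move=> bg; elim: s => [|i s IH].
  by under eq_fun do rewrite big_nil; exact: bounded_measurable_cst.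
under eq_fun do rewrite big_cons.
by case: (P i) => //; exact: bounded_measurableM.
Qed.

Variable mu : probability T R.

Lemma bounded_measurable_integrable g : bounded_measurable g ->
  mu.-integrable setT (EFin \o g).
Proof.
move=> [mg [M gM]]; apply: measurable_bounded_integrable => //.
  by rewrite -ge0_fin_numE// fin_num_measure.
exists M; split; first exact: num_real.
by move=> N MN z _; exact: le_trans (gM z) (ltW MN).
Qed.

Lemma expectation_sum (I : Type) (s : seq I) (P : pred I) (g : I -> T -> R) :
  (forall i, bounded_measurable (g i)) ->
  \int[mu]_z (\sum_(i <- s | P i) g i z) = \sum_(i <- s | P i) \int[mu]_z g i z.
Proof.
move=> bg; elim: s => [|i s IH].
  under eq_Rintegral do rewrite big_nil.
  by rewrite big_nil Rintegral_cst// mul0r.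
under eq_Rintegral do rewrite big_cons.
rewrite big_cons; case: ifP => // _.
rewrite RintegralD ?IH//; first exact: bounded_measurable_integrable.
by apply: bounded_measurable_integrable; exact: bounded_measurable_sum.
Qed.

Lemma expectationZ r g : bounded_measurable g ->
  \int[mu]_z (r * g z) = r * \int[mu]_z g z.
Proof. by move=> bg; rewrite RintegralZl//; exact: bounded_measurable_integrable. Qed.

Lemma expectation_cvg (g : nat -> T -> R) (h : T -> R) M :
  (forall n, measurable_fun setT (g n)) -> measurable_fun setT h ->
  (forall n z, `|g n z| <= M) -> {ae mu, forall z, g ^~ z @ \oo --> h z} ->
  \int[mu]_z g n z @[n --> \oo] --> \int[mu]_z h z.
Proof.
move=> mg mh gM gh.
have [] := @dominated_convergence _ _ _ mu setT measurableT
  (fun n z => (g n z)%:E) (EFin \o h) (cst M%:E).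
- by move=> n; exact/measurable_EFinP.
- exact/measurable_EFinP.
- by apply: filterS gh => z gz _; apply: cvg_EFin => //; near=> n.
- exact: (bounded_measurable_integrable (bounded_measurable_cst M)).
- by apply: aeW => z n _; rewrite lee_fin.
move=> ih _ gcv; apply: fine_cvg.
by rewrite fineK//; exact: integrable_fin_num.
Unshelve. all: by end_near. Qed.

Lemma expectation_invariant (tau : T -> T) : measurable_fun setT tau ->
  (forall S, measurable S -> mu (tau @^-1` S) = mu S) ->
  forall g, bounded_measurable g -> \int[mu]_z g (tau z) = \int[mu]_z g z.
Proof.
move=> mtau inv g bg; congr fine.
have bgt : bounded_measurable (g \o tau).
  case: bg => mg [M gM]; split; first exact: measurableT_comp.
  by exists M => z; exact: gM.
rewrite -[LHS](@integral_pushforward _ _ _ _ _ tau mtau mu setT (EFin \o g))//.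
- by apply: eq_measure_integral => A mA _; exact: inv.
- by apply/measurable_EFinP; case: bg.
- exact: bounded_measurable_integrable.
Qed.

End bounded_expectation.

(** * Mean-square oscillation of the frequencies of an exchangeable sequence *)

Definition swap (i j k : nat) : nat :=
  if k == i then j else if k == j then i else k.

Lemma swapK i j : involutive (swap i j).
Proof.
move=> k; rewrite /swap; case: (k =P i) => [->|ki].
  by rewrite eqxx; case: eqP.
case: (k =P j) => [->|kj]; first by rewrite eqxx.
by case: eqP => //; case: eqP.
Qed.

Lemma finite_permutation_swap i j : finite_permutation (swap i j).
Proof.
split; first by exists (swap i j); exact: swapK.
apply: (@sub_finite_set _ _ [set i; j]); last exact: finite_set2.
move=> k /=; rewrite /swap; case: (k =P i) => [->|_]; first by left.
by case: (k =P j) => [->|_]; [right|rewrite eqxx].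
Qed.

Section swap_invariant_law.
Context d (R : realType) (Y : measurableType d).
Local Open Scope ring_scope.

Definition swap_coords i j (z : kpow nat * Y) : kpow nat * Y :=
  (permute (swap i j) z.1, z.2).

Lemma measurable_swap_coords i j : measurable_fun setT (swap_coords i j).
Proof.
apply: measurable_fun_pair => //.
exact: (measurableT_comp (@measurable_permute _ nat (swap i j)) measurable_fst).
Qed.

Variable mu : probability (kpow nat * Y)%type R.
Hypothesis muS : forall i j S, measurable S -> mu (swap_coords i j @^-1` S) = mu S.

Let E_swap i j (g : kpow nat * Y -> R) : bounded_measurable g ->
  \int[mu]_z g (swap_coords i j z) = \int[mu]_z g z.
Proof.
move=> bg; apply: (@expectation_invariant _ _ _ mu (swap_coords i j)) => //.
  exact: measurable_swap_coords.
exact: muS.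
Qed.

Section fixed_set.
Variable T : set nat.

Definition hit i (z : kpow nat * Y) : R := \1_T (z.1 i).

Lemma bounded_measurable_hit i : bounded_measurable (hit i).
Proof.
split; last by exists 1 => z; rewrite /hit indicE ger0_norm// lern1 leq_b1.
apply: (@measurableT_comp _ _ _ (kpow nat * Y)%type nat R (\1_T : nat -> R)) => //.
exact: (measurableT_comp (@measurable_coord _ nat i) measurable_fst).
Qed.

Let bounded_hitM i j : bounded_measurable (fun z => hit i z * hit j z).
Proof. by apply: bounded_measurableM; exact: bounded_measurable_hit. Qed.

Lemma hit_swap i j k z : hit k (swap_coords i j z) = hit (swap i j k) z.
Proof. by []. Qed.

Lemma expectation_hit i : \int[mu]_z hit i z = \int[mu]_z hit 0%N z.
Proof.
rewrite -(E_swap 0%N i (bounded_measurable_hit i)).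
apply: eq_Rintegral => z _; rewrite hit_swap /swap eqxx.
by case: eqP => // ->.
Qed.

(* The swaps of 0 with [i] and of 1 with [j] carry the pair of indices to (0, 1),
   the inequality [i < j] keeping each swap away from the other index. *)
Let hitM i j : i != j ->
  \int[mu]_z (hit i z * hit j z) = \int[mu]_z (hit 0%N z * hit 1%N z).
Proof.
wlog ij : i j / (i < j)%N => [h|].
  move=> /[dup]; rewrite {1}neq_ltn => /orP[ij|ji] nij; first exact: h.
  by rewrite -(h j i)// 1?eq_sym//; apply: eq_Rintegral => z _; rewrite mulrC.
move=> _; have j0 : (0 < j)%N by rewrite (leq_ltn_trans _ ij).
transitivity (\int[mu]_z (hit 0%N z * hit j z)).
  rewrite -(E_swap 0%N i (bounded_hitM 0%N j)).
  apply: eq_Rintegral => z _; rewrite !hit_swap /swap eqxx.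
  by rewrite (gtn_eqF j0) (gtn_eqF ij).
rewrite -(E_swap 1%N j (bounded_hitM 0%N 1%N)).
apply: eq_Rintegral => z _; rewrite !hit_swap /swap eqxx/=.
by rewrite (ltn_eqF j0).
Qed.

(** Expanding the square leaves two coefficients: the diagonal one multiplies
    the sum of the squares and the other one the square of the vanishing sum. *)
Lemma expectation_sqr_centered m (c : 'I_m -> R) : \sum_(i < m) c i = 0 ->
  \int[mu]_z (\sum_(i < m) c i * hit i z) ^+ 2 <= \sum_(i < m) c i ^+ 2.
Proof.
move=> c0; pose a := \int[mu]_z hit 0%N z.
pose b := \int[mu]_z (hit 0%N z * hit 1%N z).
have hit01 i z : 0 <= hit i z <= 1.
  by rewrite /hit indicE ler0n lern1 leq_b1.
have a1 : a <= 1.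
  have <- : \int[mu]_z (cst 1 z : R) = 1.
    rewrite Rintegral_cst// mul1r -[RHS]/(fine 1%E); congr fine.
    exact: probability_setT.
  apply: le_Rintegral => //.
    exact/bounded_measurable_integrable/bounded_measurable_hit.
    exact/bounded_measurable_integrable/bounded_measurable_cst.
  by move=> z _; have /andP[] := hit01 0%N z.
have b0 : 0 <= b.
  apply: Rintegral_ge0 => z _.
  by have /andP[? _] := hit01 0%N z; have /andP[? _] := hit01 1%N z; exact: mulr_ge0.
have hit_sqr i : \int[mu]_z (hit i z * hit i z) = a.
  rewrite /a -(expectation_hit i); apply: eq_Rintegral => z _.
  by rewrite /hit indicE; case: (_ \in _); rewrite ?mulr1 ?mulr0.
have -> : \int[mu]_z (\sum_(i < m) c i * hit i z) ^+ 2 =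
    \sum_(i < m) \sum_(j < m) c i * c j * (b + (a - b) * (i == j)%:R).
  transitivity (\int[mu]_z (\sum_(i < m) \sum_(j < m)
      c i * c j * (hit i z * hit j z))).
    apply: eq_Rintegral => z _; rewrite expr2 mulr_suml; apply: eq_bigr => i _.
    by rewrite mulr_sumr; apply: eq_bigr => j _; rewrite mulrACA.
  rewrite expectation_sum => [|i]; last first.
    by apply: bounded_measurable_sum => j; exact: bounded_measurableZ.
  apply: eq_bigr => i _; rewrite expectation_sum => [|j]; last first.
    exact: bounded_measurableZ.
  apply: eq_bigr => j _; rewrite expectationZ//; congr (_ * _).
  have [->|ij] := eqVneq i j; first by rewrite hit_sqr mulr1 addrC subrK.
  by rewrite mulr0 addr0 hitM.
have -> : \sum_(i < m) \sum_(j < m) c i * c j * (b + (a - b) * (i == j)%:R) =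
    (a - b) * \sum_(i < m) c i ^+ 2.
  transitivity (\sum_(i < m) (c i * b * (\sum_(j < m) c j) + (a - b) * c i ^+ 2)).
    apply: eq_bigr => i _; rewrite mulr_sumr.
    rewrite (bigD1 i)//= [in RHS](bigD1 i)//= eqxx mulr1 addrAC.
    rewrite (eq_bigr (fun j : 'I_m => c i * b * c j)).
      by congr (_ + _); ring.
    by move=> j ji; rewrite eq_sym (negbTE ji) mulr0 addr0 mulrAC.
  by rewrite c0; under eq_bigr do rewrite mulr0 add0r; rewrite -mulr_sumr.
rewrite -[leRHS]mul1r ler_wpM2r ?sumr_ge0// => [i _|]; first exact: sqr_ge0.
by lra.
Qed.

Let freqE_coef n m z : (0 < n <= m)%N ->
  freq R z.1 T n - freq R z.1 T m =
  \sum_(i < m) (((i < n)%N)%:R / n%:R - m%:R^-1) * hit i z.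
Proof.
move=> /andP[n0 nm]; under eq_bigr do rewrite mulrBl.
rewrite sumrB -[in RHS]mulr_sumr -freqE; congr (_ - _).
rewrite freqE (big_ord_widen m (fun i => \1_T (z.1 i)) nm) big_mkcond/= mulr_sumr.
apply: eq_bigr => i _; case: ifP => _; last by rewrite !mul0r mulr0.
by rewrite mul1r.
Qed.

(** The difference is a centered combination of the indicators of the terms, whose
    coefficients have square sum [n^-1 - m^-1]. *)
Lemma expectation_sqr_freqB n m : (0 < n <= m)%N ->
  \int[mu]_z (freq R z.1 T n - freq R z.1 T m) ^+ 2 <= n%:R^-1.
Proof.
move=> nm; under eq_Rintegral do rewrite (freqE_coef _ nm).
have /andP[n0 le_nm] := nm; have m0 : (0 < m)%N by exact: leq_trans n0 le_nm.
have nR : n%:R != 0 :> R by rewrite pnatr_eq0 -lt0n.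
have mR : m%:R != 0 :> R by rewrite pnatr_eq0 -lt0n.
have sum_lt (r : R) : \sum_(i < m) ((i < n)%N)%:R * r = n%:R * r.
  rewrite -mulr_suml -natr_sum; congr (_%:R * _).
  by rewrite -big_mkcond/= -(big_ord_widen m (fun=> 1%N) le_nm) sum1_card card_ord.
have sum_cst (r : R) : \sum_(i < m) r = m%:R * r.
  by rewrite sumr_const card_ord mulr_natl.
apply: le_trans (expectation_sqr_centered _) _.
  by rewrite sumrB sum_lt sum_cst !mulfV// subrr.
have -> : \sum_(i < m) ((((i < n)%N)%:R / n%:R - m%:R^-1) ^+ 2 : R) =
    \sum_(i < m) ((((i < n)%N)%:R * (n%:R^-2 - n%:R^-1 * m%:R^-1 *+ 2)) + m%:R^-2).
  by apply: eq_bigr => i _; case: (i < n)%N => /=; field; rewrite nR mR.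
rewrite big_split/= sum_lt sum_cst.
have -> : n%:R * (n%:R^-2 - n%:R^-1 * m%:R^-1 *+ 2) + m%:R * m%:R^-2 =
   n%:R^-1 - m%:R^-1 :> R by field; rewrite nR mR.
by rewrite gerBl invr_ge0.
Qed.

End fixed_set.
End swap_invariant_law.

(** * Almost sure convergence of the frequencies *)

Section interpolation.
Variable R : realType.
Local Open Scope ring_scope.

Lemma cvgn_interpolation (u : nat -> R) (phi : nat -> nat) (e : nat -> R) :
  (forall k, (phi k < phi k.+1)%N) ->
  cvgn (u \o phi) -> e @ \oo --> 0 ->
  (forall k n, (phi k <= n <= phi k.+1)%N -> `|u (phi k) - u n| <= e k) ->
  cvgn u.
Proof.
move=> phiS cphi e0 ue; apply/cauchy_cvgP/cauchy_exP => r r0 /=.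
exists (limn (u \o phi)).
have r20 : 0 < r / 2 by rewrite divr_gt0.
have /cvgrPdist_lt/(_ _ r20)[K1 _ HK1] : u \o phi @ \oo --> limn (u \o phi) by [].
have /cvgrPdist_lt/(_ _ r20)[K2 _ HK2] := e0.
pose K := maxn K1 K2.
have find n : (phi K <= n)%N -> exists2 k, (K <= k)%N & (phi k <= n <= phi k.+1)%N.
  elim: n => [|n IH].
    by rewrite leqn0 => /eqP pK; exists K; rewrite // pK leqnn.
  rewrite leq_eqVlt => /orP[/eqP pK|].
    by exists K => //; rewrite -pK leqnn ltnW.
  rewrite ltnS => /IH[k Kk /andP[kn nk]].
  have [nk'|] := ltnP n (phi k.+1); first by exists k; rewrite // nk' (leq_trans kn).
  move=> kn'; have {kn' nk}E : phi k.+1 = n by apply/eqP; rewrite eqn_leq kn' nk.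
  exists k.+1; first exact: leqW.
  by rewrite E leqnSn/= -E.
exists (phi K) => // n /= /find[k Kk kn]; rewrite /ball/=.
have := HK1 k (leq_trans (leq_maxl _ _) Kk); have := HK2 k (leq_trans (leq_maxr _ _) Kk).
rewrite /= sub0r normrN => h2 h1.
rewrite (_ : _ - _ = (limn (u \o phi) - u (phi k)) + (u (phi k) - u n)); last first.
  by rewrite addrA subrK.
rewrite (le_lt_trans (ler_normD _ _))// (splitr r) ltrD//.
by rewrite (le_lt_trans (ue _ _ kn))// (le_lt_trans (ler_norm _)).
Qed.

(** The first [m] terms have weight [m / n] among the first [n], and frequencies lie
    between 0 and 1. *)
Lemma freqB_le (x : nat -> nat) T m n : (m <= n)%N -> (0 < n)%N ->
  `|freq R x T m - freq R x T n| <= 1 - m%:R / n%:R.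
Proof.
move=> mn n0; have nR : 0 < n%:R :> R by rewrite ltr0n.
have [->|m0] := posnP m.
  rewrite /freq invr0 mulr0 sub0r normrN mul0r subr0 -/(freq R x T n).
  by rewrite ger0_norm ?freq_ge0 ?freq_le1.
have mR : 0 < m%:R :> R by rewrite ltr0n.
have E : n%:R * freq R x T n = m%:R * freq R x T m + \sum_(m <= i < n) \1_T (x i).
  rewrite !freqE !mulVKf ?gt_eqF//.
  rewrite -(big_mkord xpredT (fun i => \1_T (x i))).
  by rewrite -(big_mkord xpredT (fun i => \1_T (x i))) (@big_cat_nat _ _ _ m).
have s0 : 0 <= \sum_(m <= i < n) (\1_T (x i) : R).
  by apply: sumr_ge0 => i _; rewrite indicE.
have s1 : \sum_(m <= i < n) (\1_T (x i) : R) <= n%:R - m%:R.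
  rewrite -natrB// -[leRHS]mulr1 mulr_natl -sumr_const_nat.
  by apply: ler_sum => i _; rewrite indicE lern1 leq_b1.
have f0 := freq_ge0 R x T m; have f1 := freq_le1 R x T m.
have -> : freq R x T n = (m%:R * freq R x T m + \sum_(m <= i < n) \1_T (x i)) / n%:R.
  by rewrite -E mulrC mulKf ?gt_eqF.
move: (\sum_(m <= i < n) _) s0 s1 {E} => s s0 s1; move: (freq R x T m) f0 f1 => f f0 f1.
have -> : 1 - m%:R / n%:R = (n%:R - m%:R) / n%:R :> R by rewrite mulrBl divff ?gt_eqF.
have -> : f - (m%:R * f + s) / n%:R = ((n%:R - m%:R) * f - s) / n%:R.
  by field; rewrite gt_eqF.
rewrite normrM (gtr0_norm (_ : 0 < n%:R^-1)) ?invr_gt0// ler_pM2r ?invr_gt0//.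
have nm : 0 <= n%:R - m%:R :> R by rewrite subr_ge0 ler_nat.
by rewrite ler_norml; apply/andP; split; nra.
Qed.

(** The fourth powers leave the mean squares of the increments summable even
    after multiplication by a square, yet their ratios tend to 1. *)
Lemma cvgn_freq_fourth_powers (x : nat -> nat) T :
  cvgn (fun k => freq R x T (k.+2 ^ 4)) -> cvgn (freq R x T).
Proof.
move=> c4; apply: (@cvgn_interpolation _ (fun k => k.+2 ^ 4)%N
  (fun k => 4 * k.+1%:R^-1)) => //.
- by move=> k; rewrite ltn_exp2r.
- rewrite -(mulr0 4); apply: cvgMr; exact: cvg_harmonic.
move=> k n /andP[kn nk]; have n0 : (0 < n)%N by rewrite (leq_trans _ kn)// expn_gt0.
apply: le_trans (freqB_le _ _ kn n0) _.
have a0 : 0 < k.+1%:R :> R by rewrite ltr0n.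
have b0 : 0 < k.+3%:R :> R by rewrite ltr0n.
have nR : 0 < n%:R :> R by rewrite ltr0n.
have y1 : k.+3%:R^-1 <= k.+1%:R^-1 :> R by rewrite lef_pV2 ?posrE// ler_nat; lia.
have aE : k.+2%:R = k.+3%:R - 1 :> R by rewrite -[k.+3%:R]natr1 addrK.
(* With y = 1 / (k + 3), the weight is at least (1 - y)^4 >= 1 - 4 y. *)
apply: (@le_trans _ _ (1 - (1 - k.+3%:R^-1) ^+ 4)).
  rewrite lerD2l lerN2 -[X in X - _](@divff _ (k.+3%:R : R)) ?gt_eqF//.
  rewrite -{2}[k.+3%:R^-1]mul1r -mulrBl -aE expr_div_n -!natrX.
  by rewrite ler_pM2l ?ltr0n ?expn_gt0// lef_pV2 ?posrE ?ltr0n ?expn_gt0// ler_nat.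
have : 0 < k.+3%:R^-1 :> R by rewrite invr_gt0.
have : k.+3%:R^-1 <= 1 :> R by rewrite invf_le1// ler1n.
move: (k.+3%:R^-1 : R) (k.+1%:R^-1 : R) y1 => y w y1 yle1 y0.
have : 0 <= y ^+ 2 * (6 - 4 * y + y ^+ 2) by apply: mulr_ge0; [exact: sqr_ge0|nra].
have -> : 1 - (1 - y) ^+ 4 = 4 * y - y ^+ 2 * (6 - 4 * y + y ^+ 2) by ring.
lra.
Qed.

End interpolation.

Section almost_sure_frequencies.
Context d (R : realType) (Y : measurableType d).
Local Open Scope ring_scope.
Variable mu : probability (kpow nat * Y)%type R.
Hypothesis muS : forall i j S, measurable S -> mu (swap_coords i j @^-1` S) = mu S.

Lemma bounded_measurable_freq T n :
  bounded_measurable (fun z : kpow nat * Y => freq R z.1 T n).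
Proof.
split; last by exists 1 => z; rewrite ger0_norm ?freq_ge0 ?freq_le1.
exact: (measurableT_comp (@measurable_freq R T n) measurable_fst).
Qed.

(** Comparison with the telescoping sum of [(k + 1)^-1 - (k + 2)^-1]. *)
Lemma sum_sqr_inv_le1 n : \sum_(0 <= k < n) (k.+2%:R^-1 ^+ 2 : R) <= 1.
Proof.
suff h : \sum_(0 <= k < n) (k.+2%:R^-1 ^+ 2 : R) <= 1 - n.+1%:R^-1.
  by rewrite (le_trans h)// gerBl invr_ge0.
elim: n => [|n IH]; first by rewrite big_geq// invr1 subrr.
rewrite big_nat_recr//= (le_trans (lerD IH (lexx _)))//.
have a0 : 0 < n.+1%:R :> R by rewrite ltr0n.
rewrite -(natr1 n.+1); move: (n.+1%:R : R) a0 => a a0.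
have b0 : 0 < a + 1 by rewrite addr_gt0.
have ab : 0 < a * (a + 1) ^+ 2 by rewrite mulr_gt0// exprn_gt0.
rewrite -subr_ge0 (_ : _ - _ = (a * (a + 1) ^+ 2)^-1) ?invr_ge0 ?ltW//.
by field; rewrite !gt_eqF.
Qed.

(** The increments [D k] along fourth powers satisfy [E (D k)^2 <= (k + 2)^-4], so
    the series of the [(k + 2)^2 (D k)^2] is almost surely finite; since
    [2 |D k| <= (k + 2)^-2 + (k + 2)^2 (D k)^2], the increments are summable. *)
Lemma ae_cvgn_freq T : {ae mu, forall z, cvgn (freq R z.1 T)}.
Proof.
pose D k (z : kpow nat * Y) := freq R z.1 T (k.+2 ^ 4) - freq R z.1 T (k.+3 ^ 4).
pose g k z := k.+2%:R ^+ 2 * D k z ^+ 2.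
have bD k : bounded_measurable (D k).
  apply: bounded_measurableD; first exact: bounded_measurable_freq.
  under eq_fun do rewrite -mulN1r.
  by apply: bounded_measurableZ; exact: bounded_measurable_freq.
have bg k : bounded_measurable (g k).
  by apply: bounded_measurableZ; exact: bounded_measurableM.
have g0 k z : 0 <= g k z by rewrite mulr_ge0// sqr_ge0.
have Eg k : \int[mu]_z g k z <= k.+2%:R^-1 ^+ 2.
  rewrite expectationZ; last exact: bounded_measurableM.
  have /(expectation_sqr_freqB muS T) h : (0 < k.+2 ^ 4 <= k.+3 ^ 4)%N.
    by rewrite expn_gt0/= leq_exp2r.
  rewrite (le_trans (ler_wpM2l _ h)) ?sqr_ge0//.
  rewrite natrX -exprVn -[4%N]/(2 + 2)%N exprD mulrA -exprMn divff ?expr1n ?mul1r//.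
have ig : (\int[mu]_z (\sum_(0 <= k <oo) (g k z)%:E) < +oo)%E.
  rewrite integral_nneseries//; last first.
  - by move=> k z _; rewrite lee_fin.
  - by move=> k; apply/measurable_EFinP; case: (bg k).
  rewrite (@le_lt_trans _ _ 1%E) ?ltry//.
  apply: lime_le.
    apply: is_cvg_nneseries => k _ _; apply: integral_ge0 => z _.
    by rewrite lee_fin.
  apply: nearW => n.
  rewrite (@le_trans _ _ (\sum_(0 <= k < n) (k.+2%:R^-1 ^+ 2)%:E)%E)//; last first.
    by rewrite sumEFin lee_fin sum_sqr_inv_le1.
  apply: lee_sum => k _; apply: le_trans (_ : (\int[mu]_z g k z)%:E <= _)%E.
    rewrite fineK//; apply: integrable_fin_num => //.
    exact: (bounded_measurable_integrable mu (bg k)).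
  by rewrite lee_fin.
have mG : measurable_fun setT (fun z => \sum_(0 <= k <oo) (g k z)%:E)%E.
  apply: ge0_emeasurable_sum => [k z _ _|k _]; first by rewrite lee_fin.
  by apply/measurable_EFinP; case: (bg k).
have G0 z : (0 <= \sum_(0 <= k <oo) (g k z)%:E)%E.
  by apply: nneseries_ge0 => k _ _; rewrite lee_fin.
have {ig mG} : mu.-integrable setT (fun z => \sum_(0 <= k <oo) (g k z)%:E)%E.
  by apply/integrableP; split => //; under eq_integral do rewrite gee0_abs//.
move=> /(integrable_ae measurableT); apply: filterS => // z /(_ I) Gz.
apply: cvgn_freq_fourth_powers.
pose M := fine (\sum_(0 <= k <oo) (g k z)%:E)%E.
have gM n : \sum_(0 <= k < n) g k z <= M.
  rewrite -lee_fin /M fineK// -sumEFin.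
  by apply: nneseries_lim_ge => k _ _; rewrite lee_fin.
have cD : cvgn (series (D ^~ z)).
  apply: normed_cvg; apply: nondecreasing_is_cvgn.
    by apply: nondecreasing_series => k _ _; exact: normr_ge0.
  exists (1 + M) => _ [n _ <-].
  rewrite /series/= (le_trans _ (lerD (sum_sqr_inv_le1 n) (gM n)))//.
  rewrite -big_split/=; apply: ler_sum => k _.
  rewrite /g -(real_normK (num_real (D k z))).
  have a0 : 0 < k.+2%:R :> R by rewrite ltr0n.
  have -> : k.+2%:R^-1 ^+ 2 + k.+2%:R ^+ 2 * `|D k z| ^+ 2 =
    (k.+2%:R^-1 - k.+2%:R * `|D k z|) ^+ 2 + 2 * `|D k z|.
    by field; rewrite gt_eqF.
  by rewrite -[leLHS]add0r lerD ?sqr_ge0// mulr_natl mulr2n lerDl.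
rewrite (_ : (fun k => _) = (fun k => freq R z.1 T (2 ^ 4) - series (D ^~ z) k)).
  by apply: is_cvgB => //; exact: is_cvg_cst.
apply/funext => k; rewrite /series/= /D -[X in _ - X]opprK -sumrN.
under eq_bigr do rewrite opprB.
by rewrite (telescope_sumr (fun k => freq R z.1 T (k.+2 ^ 4)))// opprK addrC subrK.
Qed.

Lemma expectation_freq T n : (0 < n)%N ->
  \int[mu]_z freq R z.1 T n = \int[mu]_z hit R T 0%N z.
Proof.
move=> n0; under eq_Rintegral do rewrite freqE.
have bh (i : 'I_n) := @bounded_measurable_hit _ R Y T i.
rewrite expectationZ; last exact: (bounded_measurable_sum _ _ bh).
rewrite (expectation_sum mu _ _ bh).
rewrite (eq_bigr (fun=> \int[mu]_z hit R T 0%N z)) => [|i _].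
  by rewrite sumr_const card_ord -[X in _ * X]mulr_natl mulKf// pnatr_eq0 -lt0n.
exact: expectation_hit.
Qed.

Local Open Scope ereal_scope.

Let tail t : set nat := [set m | (t < m)%N].

Let ptail t : \bar R := \int[mu]_z (hit R (tail t) 0%N z)%:E.

Let ptail_cvg : ptail @ \oo --> 0.
Proof.
pose A t := [set z : kpow nat * Y | tail t (z.1 0%N)].
have mA t : measurable (A t).
  rewrite -[X in measurable X]setTI.
  by apply: (measurableT_comp (@measurable_coord _ nat 0%N) measurable_fst).
have -> : ptail = mu \o A.
  apply/funext => t; transitivity (\int[mu]_z (\1_(A t) z)%:E).
    by apply: eq_integral => z _.
  by rewrite integral_indic// setIT.
rewrite -(measure0 mu) (_ : set0 = \bigcap_t A t); last first.
  apply/seteqP; split => // z /(_ (z.1 0%N) I).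
  by rewrite /A /tail /= ltnn.
apply: nonincreasing_cvg_mu => //.
- by rewrite -ge0_fin_numE// fin_num_measure.
- exact: bigcap_measurableType.
- move=> m n mn; apply/subsetPset => z; rewrite /A /tail /=.
  exact: leq_ltn_trans.
Qed.

(* A lower limit is defined and measurable also where the frequencies diverge. *)
Let L t (z : kpow nat * Y) := limn_einf (fun n => (freq R z.1 (tail t) n)%:E).

Let measurable_L t : measurable_fun setT (L t).
Proof.
apply: measurableT_comp => //; apply: measurable_fun_limn_esup => n.
apply: measurableT_comp => //; apply/measurable_EFinP.
by case: (bounded_measurable_freq (tail t) n).
Qed.

Let L_ge0 t z : 0 <= L t z.
Proof.
rewrite /L limn_einf_lim; apply: lime_ge; first exact: is_cvg_einfs.
apply: nearW => n; apply: le_ereal_inf_tmp => _ [k _ <-].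
by rewrite lee_fin freq_ge0.
Qed.

Let integral_L t : \int[mu]_z L t z <= ptail t.
Proof.
apply: le_trans (fatou _ _ _ _) _ => //.
- move=> n; apply/measurable_EFinP.
  by case: (bounded_measurable_freq (tail t) n).
- by move=> n z _; rewrite lee_fin freq_ge0.
rewrite (cvg_limn_einf_sup (_ : _ @ \oo --> ptail t)).1//.
apply: cvg_near_cst; exists 1%N => // n /= n0.
rewrite -[LHS]fineK; last first.
  apply: integrable_fin_num => //; apply: bounded_measurable_integrable.
  exact: bounded_measurable_freq.
rewrite -[RHS]fineK; last first.
  apply: integrable_fin_num => //; apply: bounded_measurable_integrable.
  exact: bounded_measurable_hit.
by congr (_%:E); exact: expectation_freq.
Qed.

(* The infimum over [t] of the [L t] has integral at most [ptail t] for every [t],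
   hence vanishes almost everywhere. *)
Let ae_tight : {ae mu, forall z, forall e : R, (0 < e)%R -> exists t, L t z < e%:E}.
Proof.
pose h z := einfs (L ^~ z) 0%N.
have h0 z : 0 <= h z by apply: le_ereal_inf_tmp => _ [k _ <-]; exact: L_ge0.
have mh : measurable_fun setT h by exact: measurable_fun_einfs.
have ih : \int[mu]_z h z = 0.
  apply/eqP; rewrite eq_le integral_ge0// andbT.
  have /cvg_lim <- // := ptail_cvg; apply: lime_ge; first by apply: cvgP ptail_cvg.
  apply: nearW => t; apply: le_trans (integral_L t).
  by apply: ge0_le_integral => // z _; apply: ereal_inf_lbound; exists t.
have : ae_eq mu setT h (cst 0).
  apply/(ae_eq_integral_abs mu measurableT mh).
  by under eq_integral do rewrite gee0_abs//.
apply: filterS => z /(_ I) hz e e0.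
have /ereal_inf_ltP[_ [t _ <-] Lt] : h z < e%:E by rewrite hz lte_fin.
by exists t.
Qed.

(** Fatou's lemma bounds the expected limiting frequency of the values above [t]
    by the probability that the first term exceeds [t], so no mass escapes to
    infinity and the limiting frequencies almost surely sum to 1. *)
Lemma ae_uniform_cdf_limit : {ae mu, forall z, uniform_cdf_limit R z.1}.
Proof.
have cF : {ae mu, forall z, forall t, cvgn (freq R z.1 [set m | (m <= t)%N])}.
  by apply: ae_foralln => t; exact: ae_cvgn_freq.
have aeF : Filter (nbhs (almost_everywhere mu)).
  exact: ae_filter_ringOfSetsType.
apply: filterS2 cF ae_tight => z cF tz.
apply: tight_uniform_cdf_limit => // e /tz[t].
have tE : \forall n \near \oo, (1 - freq R z.1 [set m | (m <= t)%N] n =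
    freq R z.1 (tail t) n)%R.
  by exists 1%N => // n /= n0; rewrite freq_gt.
have ct : cvgn (freq R z.1 (tail t)).
  apply/cvg_ex; exists (1 - limn (freq R z.1 [set m | (m <= t)%N]))%R.
  apply: cvg_trans (near_eq_cvg tE) _.
  by apply: cvgB; [exact: cvg_cst|exact: cF].
rewrite /L (cvg_limn_einf_sup (_ : _ @ \oo --> (limn (freq R z.1 (tail t)))%:E)).1.
  rewrite lte_fin => le; exists t.
  by apply: (cvgr_lt (limn (freq R z.1 (tail t)))) le; exact: ct.
by apply: cvg_EFin => //; near=> n.
Unshelve. all: by end_near. Qed.

Lemma probability_uniform_cdf_limit :
  mu [set z | uniform_cdf_limit R z.1] = 1.
Proof.
have mD : measurable [set z : kpow nat * Y | uniform_cdf_limit R z.1].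
  rewrite -[X in measurable X]setTI.
  exact: (@measurable_fst _ _ (kpow nat) Y measurableT _
    (measurable_uniform_cdf_limit R)).
have D0 : mu (~` [set z | uniform_cdf_limit R z.1]) = 0.
  by apply: measure_negligible; [exact: measurableC|exact: ae_uniform_cdf_limit].
have := probability_setC mu (measurableC mD); rewrite setCK => ->.
by rewrite D0 sube0.
Qed.

End almost_sure_frequencies.

(** * Conditional independence given the limiting frequencies *)

Section conditional_independence.
Context d (R : realType) (Y : measurableType d).
Local Open Scope ring_scope.

Lemma bounded_measurable_indic_snd (V : set Y) : measurable V ->
  bounded_measurable (fun z : kpow nat * Y => \1_V z.2 : R).
Proof.
move=> mV; split; last by exists 1 => z; rewrite indicE ger0_norm// lern1 leq_b1.
exact: (measurableT_comp (measurable_indic mV) measurable_snd).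
Qed.

Lemma bounded_measurable_limit_law B :
  bounded_measurable (fun z : kpow nat * Y => fine (limit_law R z.1 B)).
Proof.
split.
  apply: (measurableT_comp (fine_measurable measurableT)).
  exact: (measurableT_comp (@measurable_limit_law R B) measurable_fst).
exists 1 => z; rewrite ger0_norm ?fine_ge0// -lee_fin fineK ?fin_num_measure//.
exact: probability_le1.
Qed.

Lemma prod_hit n (B : nat -> set nat) (z : kpow nat * Y) :
  \prod_(i < n) hit R (B i) i z =
  \1_[set x : kpow nat | forall i, (i < n)%N -> B i (x i)] z.1.
Proof.
rewrite indicE; case: (boolP (_ \in _)) => [/set_mem /= zB|/negP zB].
  by rewrite big1// => i _; rewrite /hit indicE mem_set//; exact: zB.
apply: contra_notP zB => prod0; rewrite inE /= => i i_n.
apply: contrapT => zi; apply: prod0.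
by rewrite (bigD1 (Ordinal i_n))//= /hit indicE memNset// mul0r.
Qed.

Variable mu : probability (kpow nat * Y)%type R.
Hypothesis muS : forall i j S, measurable S -> mu (swap_coords i j @^-1` S) = mu S.

Let lim_hit (B : set nat) (z : kpow nat * Y) : R := fine (limit_law R z.1 B).

Let lim_hit_swap B i j z : lim_hit B (swap_coords i j z) = lim_hit B z.
Proof.
by rewrite /lim_hit limit_law_permute//; exact: finite_permutation_swap.
Qed.

(* By symmetry [W] has the same correlation with each of the terms of index at
   least [k]; averaging them brings in the limiting frequency. *)
Let expectation_lim_hit k W B : bounded_measurable W ->
  (forall j z, (k <= j)%N -> W (swap_coords k j z) = W z) ->
  \int[mu]_z (W z * lim_hit B z) = \int[mu]_z (W z * hit R B k z).
Proof.
move=> bW Winv; pose w j := \int[mu]_z (W z * hit R B j z).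
have bWh j : bounded_measurable (fun z => W z * hit R B j z).
  by apply: bounded_measurableM => //; exact: bounded_measurable_hit.
have wk j : (k <= j)%N -> w j = w k.
  move=> kj; rewrite /w.
  rewrite -(@expectation_invariant _ _ _ mu (swap_coords k j) _ _ _ (bWh k)).
  - by apply: eq_Rintegral => z _; rewrite Winv// hit_swap /swap eqxx.
  - exact: measurable_swap_coords.
  - exact: muS.
have w_cvg : arithmetic_mean w @ \oo --> w k.
  by apply: cesaro; apply: cvg_near_cst; exists k => // j /wk.
have meanE n : arithmetic_mean w n = \int[mu]_z (W z * freq R z.1 B n.+1).
  rewrite /arithmetic_mean/= /series/= big_mkord /w.
  rewrite -(expectation_sum mu _ _ (fun i : 'I_n.+1 => bWh i)).
  rewrite -expectationZ; last first.
    exact: (bounded_measurable_sum _ _ (fun i : 'I_n.+1 => bWh i)).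
  by apply: eq_Rintegral => z _; rewrite -mulr_sumr freqE mulrCA.
have [mW [M WM]] := bW.
have mean_cvg : arithmetic_mean w @ \oo --> \int[mu]_z (W z * lim_hit B z).
  rewrite (_ : arithmetic_mean w =
    fun n => \int[mu]_z (W z * freq R z.1 B n.+1)); last exact/funext.
  apply: (@expectation_cvg _ _ _ mu _ _ M).
  - move=> n; apply: measurable_funM => //.
    by case: (@bounded_measurable_freq _ R Y B n.+1).
  - by apply: measurable_funM => //; case: (bounded_measurable_limit_law B).
  - move=> n z; rewrite normrM -[leRHS]mulr1 ler_pM//.
    by rewrite ger0_norm ?freq_ge0 ?freq_le1.
  - have aeF : Filter (nbhs (almost_everywhere mu)).
      exact: ae_filter_ringOfSetsType.
    apply: filterS (ae_uniform_cdf_limit muS) => z Dz.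
    apply: cvgMr; rewrite (cvg_shiftS (freq R z.1 B)).
    by rewrite /lim_hit limit_lawE//=; exact: cvgn_freq.
exact: (cvg_unique _ mean_cvg w_cvg).
Qed.

(** [G k] has the indicators of the terms in the first [k] factors and limiting
    frequencies in the others. Passing from [k] to [k + 1] changes one factor, and
    the remaining ones are invariant under swaps of [k] with larger indices. *)
Lemma expectation_prod_limit_law n (B : nat -> set nat) (V : set Y) :
  measurable V ->
  \int[mu]_z (\1_V z.2 * \prod_(i < n) fine (limit_law R z.1 (B i))) =
  \int[mu]_z (\1_V z.2 * \prod_(i < n) hit R (B i) i z).
Proof.
move=> mV.
pose f k i z := if (i < k)%N then hit R (B i) i z else lim_hit (B i) z.
have bf k i : bounded_measurable (f k i).
  rewrite /f; case: (i < k)%N; first exact: bounded_measurable_hit.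
  exact: bounded_measurable_limit_law.
have bV := bounded_measurable_indic_snd mV.
pose G k := \int[mu]_z (\1_V z.2 * \prod_(i < n) f k i z).
have GS k : (k < n)%N -> G k = G k.+1.
  move=> kn; pose W z := \1_V z.2 * \prod_(i < n | i != Ordinal kn) f k i z.
  transitivity (\int[mu]_z (W z * lim_hit (B k) z)).
    apply: eq_Rintegral => z _; rewrite (bigD1 (Ordinal kn))//= /W.
    rewrite [X in _ * (X * _)](_ : _ = lim_hit (B k) z); last by rewrite /f ltnn.
    by rewrite mulrCA mulrC.
  rewrite (@expectation_lim_hit k).
  - apply: eq_Rintegral => z _; rewrite [in RHS](bigD1 (Ordinal kn))//= /W.
    rewrite [X in _ = _ * (X * _)](_ : _ = hit R (B k) k z); last by rewrite /f ltnSn.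
    rewrite mulrCA mulrC; congr (_ * (_ * _)); apply: eq_bigr => i ik.
    have /negbTE ik' : i != k :> nat by apply: contra ik => /eqP ik; exact/eqP/val_inj.
    by rewrite /f (ltnS i k) (leq_eqVlt i k) ik'.
  - apply: bounded_measurableM => //.
    exact: (bounded_measurable_prod _ _ (fun i : 'I_n => bf k i)).
  - move=> j z kj; rewrite /W; congr (_ * _); apply: eq_bigr => i ik.
    rewrite /f; case: ifP => ltik; last exact: lim_hit_swap.
    by rewrite hit_swap /swap !ltn_eqF// (leq_trans ltik).
suff GE k : (k <= n)%N -> G 0%N = G k.
  transitivity (G 0%N); first by [].
  rewrite (GE n)//; apply: eq_Rintegral => z _; congr (_ * _).
  by apply: eq_bigr => i _; rewrite /f ltn_ord.
elim: k => [_|k IH kn]; first by [].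
exact: etrans (IH (ltnW kn)) (GS k kn).
Qed.

End conditional_independence.

(** * Empirical adequacy *)

Lemma product_dirac d d' (R : realType) (X : measurableType d)
    (Y : measurableType d') (x : X) (y : Y) (S : set (X * Y)) : measurable S ->
  product_subprobability
    (dirac x : subprobability X R, dirac y : subprobability Y R) S = \d_(x, y) S.
Proof.
move=> mS; rewrite /product_subprobability/= /product_measure1/=.
rewrite integral_dirac//; last exact: measurable_fun_xsection.
by rewrite diracT mul1e !diracE mem_xsection.
Qed.

Section empirical_adequacy.
Context (R : realType) dA dY (A : measurableType dA) (Y : measurableType dY).
Variable f : pkernel R A (kpow nat * Y)%type.

Lemma exchangeable_swap : exchangeable f -> forall a, pdom f a ->
  forall i j S, measurable S -> f a (swap_coords i j @^-1` S) = f a S.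
Proof.
move=> fX a fa i j S mS.
have [domE kerE] := fX _ (finite_permutation_swap i j).
rewrite -[RHS]kerE ?domE//=.
rewrite /pcomp_ker (_ : pdom _ = setT); last exact: setXTT.
rewrite (eq_integral (fun z => (\1_S (swap_coords i j z))%:E)); last first.
  by move=> z _; exact: product_dirac.
have mt : measurable (swap_coords i j @^-1` S : set (kpow nat * Y)).
  by rewrite -[X in measurable X]setTI; exact: measurable_swap_coords.
transitivity (\int[f a]_z (\1_(swap_coords i j @^-1` S) z)%:E).
  by rewrite integral_indic// setIT.
by apply: eq_integral => z _.
Qed.

Definition cylinder_rectangles : set (set (kpow nat * Y)) :=
  [set C `*` V | C in head_cylinders nat & V in measurable].

Lemma measurable_cylinder_rectangles :
  @measurable _ (kpow nat * Y)%type = <<s cylinder_rectangles >>.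
Proof.
apply/seteqP; split; last first.
  apply: smallest_sub; first exact: sigma_algebra_measurable.
  move=> _ [C /measurable_head_cylinder mC [V mV <-]]; exact: measurableX.
apply: smallest_sub; first exact: smallest_sigma_algebra.
have [s0 sC sU] := smallest_sigma_algebra setT cylinder_rectangles.
have hT : head_cylinders nat setT.
  by exists 0%N, (fun=> setT); split => //; apply/seteqP; split.
move=> S [[C mC <-]|[V mV <-]]; last first.
  by apply: sub_sigma_algebra; exists setT => //; exists V => //; rewrite setTI setTX.
rewrite setTI; move: mC; rewrite kpow_head_cylinders => mC.
suff : <<s head_cylinders nat >> `<=`
    [set C | <<s cylinder_rectangles >> (fst @^-1` C : set (kpow nat * Y))].
  exact.
apply: smallest_sub.
  split => /=.
  - by rewrite preimage_set0; exact: s0.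
  - move=> B /= mB; rewrite setTD preimage_setC -setTD.
    exact: sC.
  - move=> F /= mF; rewrite preimage_bigcup.
    exact: sU.
move=> B hB /=; apply: sub_sigma_algebra; exists B => //.
by exists setT => //; rewrite setXT.
Qed.

Lemma cylinder_rectangles_setI : setI_closed cylinder_rectangles.
Proof.
move=> _ _ [C hC [V mV <-]] [C' hC' [V' mV' <-]].
exists (C `&` C'); first exact: head_cylinders_setI.
by exists (V `&` V'); [exact: measurableI|rewrite setXI].
Qed.

(** Almost every sequence lies in the domain, so the composite has the same domain as
    [f] and its integral extends to the whole space; on a rectangle it is then an
    expected product of limiting frequencies. *)
Lemma sampling_adequate : exchangeable f ->
  pk_eq (pk_comp (pk_tensor (samplingN R) (pk_id R Y)) f) f.
Proof.
move=> fX.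
pose D := [set z : kpow nat * Y | uniform_cdf_limit R z.1].
have DE : pdom (pk_tensor (samplingN R) (pk_id R Y)) = D.
  by rewrite /= /ptensor_dom/= /D; apply/seteqP; split => [z []//|z Dz]; split.
have mD : measurable D by rewrite -DE; exact: measurable_pdom.
have prob a : pdom f a -> exists mu : probability (kpow nat * Y)%type R,
    mu = f a :> (set _ -> \bar R).
  by move=> fa; apply: measure_probability; exact: pker_setT.
have faD a : pdom f a -> f a D = 1.
  move=> fa; have [mu muE] := prob a fa; rewrite -muE.
  apply: probability_uniform_cdf_limit => i j S mS.
  by rewrite muE; exact: exchangeable_swap.
split.
  apply/seteqP; split => a /=; first by case.
  by move=> fa; split => //; rewrite DE faD.
move=> a [fa _] S mS.
apply: (measure_unique cylinder_rectangles (fun=> setT)) => //.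
- exact: measurable_cylinder_rectangles.
- exact: cylinder_rectangles_setI.
- move=> _; exists setT.
    by exists 0%N, (fun=> setT); split => //; apply/seteqP; split.
  by exists setT => //; rewrite setXTT.
- by apply/seteqP; split => // z _; exists 0%N.
- move=> _ [C hC [V mV <-]].
  have mC := measurable_head_cylinder hC; have [n [B [mB CE]]] := hC.
  have [mu muE] := prob a fa.
  have muS i j T : measurable T -> mu (swap_coords i j @^-1` T) = mu T.
    by move=> mT; rewrite muE; exact: exchangeable_swap.
  rewrite /= /pcomp_ker DE -muE.
  pose g (z : kpow nat * Y) : R :=
    (\1_V z.2 * \prod_(i < n) fine (limit_law R z.1 (B i)))%R.
  pose h (z : kpow nat * Y) : R := (\1_V z.2 * \prod_(i < n) hit R (B i) i z)%R.
  have bV := @bounded_measurable_indic_snd _ R Y V mV.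
  have bg : bounded_measurable g.
    apply: bounded_measurableM => //.
    exact: (bounded_measurable_prod _ _
      (fun i : 'I_n => @bounded_measurable_limit_law _ R Y (B i))).
  have bh : bounded_measurable h.
    apply: bounded_measurableM => //.
    exact: (bounded_measurable_prod _ _
      (fun i : 'I_n => @bounded_measurable_hit _ R Y (B i) i)).
  have g0 z : (0 <= g z)%R.
    by rewrite mulr_ge0// ?indicE// prodr_ge0// => i _; exact: fine_ge0.
  rewrite (eq_integral (EFin \o g)) => [|z _]; last first.
    transitivity (limit_law_iid R z.1 C * \d_(z.2) V).
      exact: product_measure1E.
    have -> : limit_law_iid R z.1 C = \prod_(i < n) limit_law R z.1 (B i).
      by rewrite CE; exact: limit_law_iidP.
    rewrite diracE muleC /g /= indicE EFinM -prodEFin.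
    by congr (_ * _); apply: eq_bigr => i _; rewrite fineK// fin_num_measure.
  transitivity (\int[mu]_z (g z)%:E).
    rewrite [RHS](@ge0_negligible_integral _ _ _ mu setT (~` D)) ?setTD ?setCK//.
    - exact: measurableC.
    - by apply/measurable_EFinP; case: bg.
    - by move=> z _; rewrite lee_fin.
    - by apply: (etrans (probability_setC mu mD)); rewrite muE faD// subee.
  have fin k : bounded_measurable k -> \int[mu]_z (k z)%:E = (\int[mu]_z k z)%:E.
    move=> bk; rewrite fineK//; apply: integrable_fin_num => //.
    exact: bounded_measurable_integrable.
  rewrite fin// (expectation_prod_limit_law muS)// -fin//.
  transitivity (\int[mu]_z (\1_(C `*` V) z)%:E); last first.
    by rewrite integral_indic// ?setIT//; exact: measurableX.
  apply: eq_integral => z _; congr (_%:E).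
  by rewrite prod_hit -CE !indicE in_setX -natrM mulnb andbC.
- by move=> _; rewrite (le_lt_trans (@sprobability_setT _ _ R
    (pk_comp (pk_tensor (samplingN R) (pk_id R Y)) f a)))// ltry.
Qed.

End empirical_adequacy.

Unset Implicit Arguments.

Theorem theorem3p8 (R : realType) :
  exists es : pkernel R (kpow nat) nat,
    [/\ forall x : kpow nat, pdom es x <-> uniform_cdf_limit R x,
        forall x : kpow nat, pdom es x -> forall T : set nat,
          (freq R x T n)%:E @[n --> \oo] --> es x T
      & empirical_sampling es].
Proof.
exists (sampling R); split => //.
  by move=> x Dx T; exact: freq_cvg_limit_law.
split; first exact: sampling_permute.
exists (samplingN R); first exact: is_kpower_samplingN.
by move=> dA dY A Y _ _ f; exact: sampling_adequate.
Qed.
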